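(* For $\ell\in\mathbb{N}$ and $k\in\mathbb{R}_+$ with $k\le\ell$, the generalized Wu function $\varphi_{\ell,k}$ satisfies, for $0\le r\le2$, $$\varphi_{\ell,k}(r)=\frac{2^{2\ell-k+1}\Gamma(\ell+1)}{\Gamma(\ell-k+1)}\Big(1-\frac{r^2}{4}\Big)^{\ell-k}\left[\frac{1^{(\ell)}}{(3/2)^{(\ell)}}-\sum_{n=0}^{\ell}\frac{(-\ell)^{(n)}(1/2)^{(n)}}{(3/2)^{(n)}}\frac1{n!}\,{}_2F_1\!\left(-n-\tfrac12,1;\ell-k+1;1-\tfrac{r^2}{4}\right)\right].$$
   Context: $\mathbb{R}_+=[0,\infty)$. $f_\ell(r)=(1-r^2)_+^\ell$, $f_\ell*f_\ell(r)=\int_{\mathbb{R}}f_\ell(|y|)f_\ell(|r-y|)dy$ for $r\ge0$. The $f$-form is $\mathcal{F}\varphi(r)=\varphi(\sqrt{2r})$, with inverse $\mathcal{F}^{-1}\varphi(r)=\varphi(r^2/2)$. For $\nu>0$, $I_\nu\varphi(r)=\int_r^\infty\frac{(x-r)^{\nu-1}}{\Gamma(\nu)}\varphi(x)dx$; $I_0=\mathrm{id}$; $I_{-n}=(-1)^n d^n/dr^n$ ($n\in\mathbb{N}$); $I_{-\nu}=I_{n-\nu}I_{-n}$ with $n=\lceil\nu\rceil$. The generalized Wu function is $\varphi_{\ell,k}:=\mathcal{F}^{-1}I_{-k}\mathcal{F}(f_\ell*f_\ell)$ for real $0\le k\le\ell$ (for integer $k$ this equals $\mathscr{D}^k(f_\ell*f_\ell)$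 with $\mathscr{D}\varphi(r)=-\frac1r\varphi'(r)$). Pochhammer symbol: $a^{(0)}=1$, $a^{(n)}=a(a+1)\cdots(a+n-1)$; ${}_2F_1(a,b;c;z)=\sum_{n\ge0}\frac{a^{(n)}b^{(n)}}{c^{(n)}}\frac{z^n}{n!}$. *)

(* Defs.v *)
From Stdlib Require Import Reals.
From Coquelicot Require Import Coquelicot.
Open Scope R_scope.

Definition rpow (x a : R) : R :=
  if Req_EM_T x 0 then (if Req_EM_T a 0 then 1 else 0) else Rpower x a.

Definition Gamma (x : R) : R :=
  RInt_gen (fun t => Rpower t (x - 1) * exp (- t))
    (at_right 0) (Rbar_locally p_infty).

Fixpoint poch (a : R) (n : nat) : R :=
  match n with
  | O => 1
  | S m => poch a m * (a + INR m)
  end.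

Definition hyp2F1 (a b c z : R) : R :=
  Series (fun n => poch a n * poch b n / poch c n * z ^ n / INR (Factorial.fact n)).

Definition f_ell (l : nat) (r : R) : R :=
  if Rlt_dec (Rabs r) 1 then (1 - r ^ 2) ^ l else 0.

Definition conv_ff (l : nat) (r : R) : R :=
  RInt_gen (fun y => f_ell l (Rabs y) * f_ell l (Rabs (r - y)))
    (Rbar_locally m_infty) (Rbar_locally p_infty).

Definition Fform (phi : R -> R) (r : R) : R := phi (sqrt (2 * r)).
Definition Finv (phi : R -> R) (r : R) : R := phi (r ^ 2 / 2).

(* derivative of a function on R_+ (one-sided from the right, which is
   the derivative at interior points where it exists and the boundary
   derivative at 0) *)
Definition Dright (g : R -> R) (x : R) : R :=
  iota (fun l : R => filterlim (fun h => (g (x + h) - g x) / h)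
                        (at_right 0) (locally l)).

Fixpoint Dright_n (n : nat) (g : R -> R) : R -> R :=
  match n with
  | O => g
  | S m => Dright (Dright_n m g)
  end.

Definition Ipos (nu : R) (phi : R -> R) : R -> R :=
  if Req_EM_T nu 0 then phi
  else fun r => RInt_gen (fun x => Rpower (x - r) (nu - 1) / Gamma nu * phi x)
                  (at_right r) (Rbar_locally p_infty).

Definition nat_ceil (k : R) : nat := Z.to_nat (- Int_part (- k)).

Definition Ineg_nat (n : nat) (phi : R -> R) : R -> R :=
  fun r => (-1) ^ n * Dright_n n phi r.

Definition Ineg (nu : R) (phi : R -> R) : R -> R :=
  Ipos (INR (nat_ceil nu) - nu) (Ineg_nat (nat_ceil nu) phi).

Definition wu (l : nat) (k : R) : R -> R :=
  Finv (Ineg k (Fform (conv_ff l))).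

(* Main.v *)
Require Import Defs.
From Stdlib Require Import ssreflect Reals ZArith Factorial Lra Lia Psatz.
From Coquelicot Require Import Coquelicot.
Open Scope R_scope.

(** With [u = r / 2], the substitutions [x = (sqrt (2 (1 + u^2) - t^2) ± t) / 2] turn the
    convolution into [2^(2l+1) * ∫_u^1 ((1 - x^2) (x^2 - u^2))^l dx].  In the variable
    [w = u^2 = s / 2], where [s = r^2 / 2] is the variable of the f-form, each derivative
    lowers the exponent of [x^2 - w] by one, the moving endpoint contributing nothing; [l]
    derivatives leave [∫_{sqrt w}^1 (1 - x^2)^l dx], a constant minus a combination of the
    powers [w^(n + 1/2)].  Their binomial series in [z = 1 - w] converge uniformly on
    [0 <= z <= 1] (the remainder is bounded by its value at [z = 1]), hence may be
    integrated termwise, first [l - n] times and then fractionally, which turns the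
    binomial coefficients into those of [2F1(-n - 1/2, 1; l - k + 1; z)]. *)

(** * The integrals ∫_{sqrt w}^1 (1 - x^2)^l (x^2 - w)^m dx *)

(** The difficulty sits at [r = 0], where [w = 0] and [z = 1]: there [sqrt w] is not differentiable,
    and the binomial series is on the boundary of its disc of convergence. Neither the Leibniz rule
    for a moving endpoint nor power series calculus reaches that point. The derivatives of [lens]
    are therefore obtained by squeezing difference quotients between monotone bounds, which works at
    every real [w], and the series are handled through error bounds on the closed interval. With [n]
    the ceiling of [k], [m = l - n] and [nu = n - k], the fractional integral meets the monomials
    [(2 - x)^(m + j)], whose Beta integrals are elementary because the exponent is a natural number.
    Only the quotient [Gamma (nu + m + 1) / Gamma nu] survives, a Pochhammer symbol; what is used
    about [Gamma] is convergence and positivity on [(0, 1]], the functional equation and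
    [Gamma 1 = 1]. *)

Ltac smooth := apply: ex_derive_continuous; auto_derive; auto.

Lemma Rabs_of_ball (x y e : R) : ball x e y -> Rabs (y - x) < e.
Proof. exact (fun H => H). Qed.

Lemma ball_of_Rabs (x y e : R) : Rabs (y - x) < e -> ball x e y.
Proof. exact (fun H => H). Qed.

(** The cap at [1] makes the interval degenerate for [w >= 1], which encodes the compact support of
    the convolution. For [w < 0] the value [sqrt w] is [0], so the interval stays [[0, 1]] and the
    function continues as a polynomial in [w]; two-sided derivatives thus make sense at [w = 0]. *)
Definition lens (l m : nat) (w : R) : R :=
  RInt (fun x => (1 - x ^ 2) ^ l * (x ^ 2 - w) ^ m) (Rmin 1 (sqrt w)) 1.

Lemma ex_RInt_lens_integrand (l m : nat) (w a b : R) :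
  ex_RInt (fun x => (1 - x ^ 2) ^ l * (x ^ 2 - w) ^ m) a b.
Proof.
  apply: ex_RInt_continuous => x _. smooth.
Qed.

Lemma Rmin_sqrt_bounds (w : R) : 0 <= Rmin 1 (sqrt w) <= 1.
Proof.
  split; [apply Rmin_glb; [lra | apply sqrt_pos] | apply Rmin_l].
Qed.

Lemma Rmin_sqrt_le (w w' : R) : w <= w' -> Rmin 1 (sqrt w) <= Rmin 1 (sqrt w').
Proof.
  intros H. apply Rle_min_compat_l, sqrt_le_1_alt, H.
Qed.

Lemma Rmin_sqrt_lt_sqr (w x : R) : Rmin 1 (sqrt w) < x < 1 -> w < x ^ 2.
Proof.
  intros [H1 H2]. assert (H : sqrt w < x).
  { revert H1. unfold Rmin. destruct (Rle_dec 1 (sqrt w)); lra. }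
  assert (H0 := sqrt_pos w).
  destruct (Rle_lt_dec w 0) as [Hw|Hw]; [nra|].
  rewrite <- (pow2_sqrt w) by lra. nra.
Qed.

Lemma lt_Rmin_sqrt_sqr (w x : R) : 0 <= x < Rmin 1 (sqrt w) -> x ^ 2 < w.
Proof.
  intros [H1 H2]. assert (H : x < sqrt w) by (apply Rlt_le_trans with (1 := H2), Rmin_r).
  destruct (Rle_lt_dec w 0) as [Hw|Hw].
  - rewrite sqrt_neg_0 in H; lra.
  - rewrite <- (pow2_sqrt w) by lra. nra.
Qed.

Lemma lens_ge_1 (l m : nat) (w : R) : 1 <= w -> lens l m w = 0.
Proof.
  intros H. unfold lens. rewrite Rmin_left; [apply: RInt_point|].
  rewrite <- sqrt_1. now apply sqrt_le_1_alt.
Qed.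

(** Convexity of the power: a chord slope lies between the slopes at its ends. *)
Lemma pow_succ_diff_bounds (m : nat) (a b : R) : 0 <= b <= a ->
  INR (S m) * (a - b) * b ^ m <= a ^ S m - b ^ S m <= INR (S m) * (a - b) * a ^ m.
Proof.
  intros H. induction m as [|m IH]; [simpl; lra|].
  rewrite S_INR. assert (Ha := pow_incr b a (S m) H).
  assert (Hb : 0 <= b ^ S m) by (apply pow_le; lra).
  replace (a ^ S (S m)) with (a * a ^ S m) by reflexivity.
  replace (b ^ S (S m)) with (b * b ^ S m) by reflexivity.
  replace (a * a ^ S m - b * b ^ S m)
    with (a * (a ^ S m - b ^ S m) + (a - b) * b ^ S m) by ring.
  split.
  - apply Rle_trans with (b * (INR (S m) * (a - b) * b ^ m) + (a - b) * b ^ S m).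
    + right. change (b ^ S m) with (b * b ^ m). ring.
    + assert (b * (INR (S m) * (a - b) * b ^ m) <= b * (a ^ S m - b ^ S m))
        by (apply Rmult_le_compat_l; lra). nra.
  - apply Rle_trans with (a * (INR (S m) * (a - b) * a ^ m) + (a - b) * a ^ S m).
    + assert (a * (a ^ S m - b ^ S m) <= a * (INR (S m) * (a - b) * a ^ m))
        by (apply Rmult_le_compat_l; lra). nra.
    + right. change (a ^ S m) with (a * a ^ m). ring.
Qed.

Lemma lens_weight_nonneg (l : nat) (x : R) : 0 <= x <= 1 -> 0 <= (1 - x ^ 2) ^ l.
Proof. intros H. apply pow_le. nra. Qed.

(** A finite-increment form of [d/dw lens l (S m) = - (S m) lens l m], free of any derivative of the
    endpoint. On the common interval [[L', 1]] the chord bounds are integrated pointwise. On the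
    strip [[L, L']] the integrand is nonnegative, and [x^2 < w'] bounds one factor [x^2 - w] by
    [w' - w], so the strip fits into the same upper bound. *)
Lemma lens_succ_diff_bounds (l m : nat) (w w' : R) : w <= w' ->
  INR (S m) * (w' - w) * lens l m w' <= lens l (S m) w - lens l (S m) w'
  <= INR (S m) * (w' - w) * lens l m w.
Proof.
  intros Hw. unfold lens.
  assert (HL := Rmin_sqrt_le w w' Hw).
  assert (B := Rmin_sqrt_bounds w). assert (B' := Rmin_sqrt_bounds w').
  assert (S1 := Rmin_sqrt_lt_sqr w). assert (S1' := Rmin_sqrt_lt_sqr w').
  assert (S2' := lt_Rmin_sqrt_sqr w').
  set (L := Rmin 1 (sqrt w)) in *. set (L' := Rmin 1 (sqrt w')) in *.
  set (f := fun (n : nat) v x => (1 - x ^ 2) ^ l * (x ^ 2 - v) ^ n).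
  assert (Hf : forall n v a b, ex_RInt (f n v) a b)
    by (intros; apply ex_RInt_lens_integrand).
  fold (f m w) (f m w') (f (S m) w) (f (S m) w').
  assert (Ch : forall n, RInt (f n w) L 1 = RInt (f n w) L L' + RInt (f n w) L' 1)
    by (intros n; symmetry; apply: RInt_Chasles; apply Hf).
  rewrite !Ch.
  assert (E : RInt (f (S m) w) L' 1 - RInt (f (S m) w') L' 1
              = RInt (fun x => f (S m) w x - f (S m) w' x) L' 1).
  { symmetry. apply: RInt_minus; apply Hf. }
  assert (Hm : forall n v a b c, ex_RInt (fun x => c * f n v x) a b)
    by (intros; apply: ex_RInt_scal; apply Hf).
  assert (Em : forall n v a b c, RInt (fun x => c * f n v x) a b = c * RInt (f n v) a b)
    by (intros; apply: RInt_scal; apply Hf).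
  assert (ED : ex_RInt (fun x => f (S m) w x - f (S m) w' x) L' 1)
    by (apply: ex_RInt_minus; apply Hf).
  assert (I1 : INR (S m) * (w' - w) * RInt (f m w') L' 1
               <= RInt (fun x => f (S m) w x - f (S m) w' x) L' 1).
  { rewrite <- Em. apply RInt_le; auto; [lra|].
    intros x Hx. specialize (S1' x Hx).
    destruct (pow_succ_diff_bounds m (x ^ 2 - w) (x ^ 2 - w')) as [P _]; [lra|].
    replace (x ^ 2 - w - (x ^ 2 - w')) with (w' - w) in P by ring.
    unfold f. assert (W := lens_weight_nonneg l x ltac:(lra)).
    apply (Rmult_le_compat_l _ _ _ W) in P.
    apply: Rle_trans; [|apply: Rle_trans; [exact P|]]; right; ring. }
  assert (I2 : RInt (fun x => f (S m) w x - f (S m) w' x) L' 1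
               <= INR (S m) * (w' - w) * RInt (f m w) L' 1).
  { rewrite <- Em. apply RInt_le; auto; [lra|].
    intros x Hx. specialize (S1' x Hx).
    destruct (pow_succ_diff_bounds m (x ^ 2 - w) (x ^ 2 - w')) as [_ P]; [lra|].
    replace (x ^ 2 - w - (x ^ 2 - w')) with (w' - w) in P by ring.
    unfold f. assert (W := lens_weight_nonneg l x ltac:(lra)).
    apply (Rmult_le_compat_l _ _ _ W) in P.
    apply: Rle_trans; [|apply: Rle_trans; [exact P|]]; right; ring. }
  assert (I3 : 0 <= RInt (f (S m) w) L L').
  { apply RInt_ge_0; auto. intros x Hx. apply Rmult_le_pos.
    - apply lens_weight_nonneg; lra.
    - specialize (S1 x ltac:(lra)). apply pow_le. lra. }
  assert (I4 : RInt (f (S m) w) L L' <= INR (S m) * (w' - w) * RInt (f m w) L L').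
  { rewrite <- Em. apply RInt_le; auto.
    intros x Hx. specialize (S1 x ltac:(lra)). specialize (S2' x ltac:(lra)).
    unfold f. change ((x ^ 2 - w) ^ S m) with ((x ^ 2 - w) * (x ^ 2 - w) ^ m).
    assert (W := lens_weight_nonneg l x ltac:(lra)).
    assert (W2 : 0 <= (x ^ 2 - w) ^ m) by (apply pow_le; lra).
    assert (1 <= INR (S m)) by (rewrite S_INR; assert (H := pos_INR m); lra).
    assert (x ^ 2 - w <= INR (S m) * (w' - w)) by nra.
    assert (W3 : 0 <= (1 - x ^ 2) ^ l * (x ^ 2 - w) ^ m) by now apply Rmult_le_pos.
    apply (Rmult_le_compat_l _ _ _ W3) in H0.
    apply: Rle_trans; [|apply: Rle_trans; [exact H0|]]; right; ring. }
  rewrite Rmult_plus_distr_l. lra.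
Qed.

(** For exponent [0] the integrand need not vanish at the moving endpoint, so the increment is only
    controlled by the displacement of that endpoint, the weight being at most [1]. Continuity
    follows, and nothing stronger is asked at this level. *)
Lemma lens_0_diff_bounds (l : nat) (w w' : R) : w <= w' ->
  0 <= lens l 0 w - lens l 0 w' <= Rmin 1 (sqrt w') - Rmin 1 (sqrt w).
Proof.
  intros Hw. unfold lens.
  assert (HL := Rmin_sqrt_le w w' Hw).
  assert (B := Rmin_sqrt_bounds w). assert (B' := Rmin_sqrt_bounds w').
  set (L := Rmin 1 (sqrt w)) in *. set (L' := Rmin 1 (sqrt w')) in *.
  assert (H0 : forall a b v, RInt (fun x => (1 - x ^ 2) ^ l * (x ^ 2 - v) ^ 0) a b
    = RInt (fun x => (1 - x ^ 2) ^ l) a b).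
  { intros. apply RInt_ext. intros. simpl. ring. }
  rewrite !H0.
  assert (Hf : forall a b, ex_RInt (fun x => (1 - x ^ 2) ^ l) a b)
    by (intros; apply: ex_RInt_continuous => x _; smooth).
  assert (Ch : RInt (fun x => (1 - x ^ 2) ^ l) L 1 =
    RInt (fun x => (1 - x ^ 2) ^ l) L L' + RInt (fun x => (1 - x ^ 2) ^ l) L' 1)
    by (symmetry; apply: RInt_Chasles; apply Hf).
  rewrite Ch.
  assert (0 <= RInt (fun x => (1 - x ^ 2) ^ l) L L').
  { apply RInt_ge_0; auto. intros; apply lens_weight_nonneg; lra. }
  assert (RInt (fun x => (1 - x ^ 2) ^ l) L L' <= RInt (fun _ => 1) L L').
  { apply RInt_le; auto. apply ex_RInt_const. intros.
    rewrite -[X in _ <= X](pow1 l). apply pow_incr. nra. }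
  rewrite RInt_const in H1. unfold scal in H1; simpl in H1; unfold mult in H1; simpl in H1.
  simpl in *. lra.
Qed.

Lemma lens_nonneg (l m : nat) (w : R) : 0 <= lens l m w.
Proof.
  assert (B := Rmin_sqrt_bounds w). apply RInt_ge_0; [lra| apply ex_RInt_lens_integrand|].
  intros x Hx. apply Rmult_le_pos; [apply lens_weight_nonneg; lra|].
  apply pow_le. assert (H := Rmin_sqrt_lt_sqr w x Hx). lra.
Qed.

Lemma lens_decr (l m : nat) (w w' : R) : w <= w' -> lens l m w' <= lens l m w.
Proof.
  intros H. destruct m as [|m].
  - assert (B := lens_0_diff_bounds l w w' H). lra.
  - assert (B := lens_succ_diff_bounds l m w w' H).
    assert (0 <= INR (S m) * (w' - w) * lens l m w').
    { apply Rmult_le_pos; [apply Rmult_le_pos; [apply pos_INR|lra] | apply lens_nonneg]. }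
    lra.
Qed.

Lemma Rmin_sqrt_continuous (w : R) : continuous (fun w => Rmin 1 (sqrt w)) w.
Proof.
  apply (continuous_ext (fun w => (1 + sqrt w - Rabs (1 - sqrt w)) / 2)).
  { intros x. unfold Rmin, Rabs. destruct (Rle_dec 1 (sqrt x)), (Rcase_abs (1 - sqrt x)); lra. }
  assert (C := continuous_sqrt w).
  apply: (continuous_mult (K := R_AbsRing)); [|apply continuous_const].
  apply: (continuous_minus (V := R_NormedModule)).
  - apply: (continuous_plus (V := R_NormedModule)); [apply continuous_const|exact C].
  - apply continuous_comp; [|apply continuous_Rabs].
    apply: (continuous_minus (V := R_NormedModule)); [apply continuous_const|exact C].
Qed.

Lemma continuous_squeeze (f g : R -> R) (x : R) : continuous g x ->
  locally x (fun y => Rabs (f y - f x) <= Rabs (g y - g x)) -> continuous f x.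
Proof.
  intros Hg Hl. apply filterlim_locally. intros eps.
  assert (Hg' := proj1 (filterlim_locally g (g x)) Hg eps).
  generalize (filter_and _ _ Hl Hg'). apply filter_imp. intros y [H1 H2].
  apply Rabs_of_ball in H2. apply ball_of_Rabs. lra.
Qed.

Lemma lens_continuous (l m : nat) (w : R) : continuous (lens l m) w.
Proof.
  destruct m as [|m].
  - apply (continuous_squeeze _ (fun w => Rmin 1 (sqrt w))); [apply Rmin_sqrt_continuous|].
    apply filter_forall. intros y. destruct (Rle_lt_dec w y) as [H|H].
    + assert (B := lens_0_diff_bounds l w y H).
      rewrite Rabs_left1 ?Rabs_pos_eq; lra.
    + assert (B := lens_0_diff_bounds l y w ltac:(lra)).
      rewrite Rabs_pos_eq ?Rabs_left1; lra.
  (* Since [lens l m] decreases, its value at [w - 1] dominates it on the unit neighbourhood of [w],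
     so [K] is a local Lipschitz constant. *)
  - set (K := INR (S m) * lens l m (w - 1)).
    assert (HK : 0 <= K) by (apply Rmult_le_pos; [apply pos_INR|apply lens_nonneg]).
    apply (continuous_squeeze _ (fun y => K * y)); [smooth|].
    exists (mkposreal 1 Rlt_0_1). intros y Hy.
    apply Rabs_of_ball in Hy. simpl in Hy. apply Rabs_lt_between in Hy.
    replace (K * y - K * w) with (K * (y - w)) by ring.
    rewrite Rabs_mult (Rabs_pos_eq K HK).
    destruct (Rle_lt_dec w y) as [H|H].
    + assert (B := lens_succ_diff_bounds l m w y H).
      assert (D := lens_decr l (S m) w y H).
      assert (D' := lens_decr l m (w - 1) w ltac:(lra)).
      rewrite Rabs_left1; [|lra]. rewrite Rabs_pos_eq; [|lra].
      apply (Rmult_le_compat_l (INR (S m) * (y - w))) in D';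
        [unfold K; lra | apply Rmult_le_pos; [apply pos_INR|lra]].
    + assert (B := lens_succ_diff_bounds l m y w ltac:(lra)).
      assert (D := lens_decr l (S m) y w ltac:(lra)).
      assert (D' := lens_decr l m (w - 1) y ltac:(lra)).
      rewrite Rabs_pos_eq; [|lra]. rewrite Rabs_left1; [|lra].
      apply (Rmult_le_compat_l (INR (S m) * (w - y))) in D';
        [unfold K; lra | apply Rmult_le_pos; [apply pos_INR|lra]].
Qed.

(** By [lens_succ_diff_bounds] the difference quotient lies between the values of the claimed
    derivative at [w] and at [w + h]; continuity of [lens l m] closes the gap. The singular points
    [w = 0] and [w = 1] of the endpoint do not interfere. *)
Lemma lens_derive (l m : nat) (w : R) :
  is_derive (lens l (S m)) w (- INR (S m) * lens l m w).
Proof.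
  apply is_derive_Reals. intros eps Heps.
  assert (HS : 0 < INR (S m)) by (apply lt_0_INR; lia).
  assert (He' : 0 < eps / INR (S m)) by (apply Rdiv_lt_0_compat; lra).
  destruct (proj1 (filterlim_locally _ _) (lens_continuous l m w) (mkposreal _ He'))
    as [d Hd].
  exists d. intros h Hh0 Hh.
  assert (Hb : Rabs (lens l m (w + h) - lens l m w) < eps / INR (S m)).
  { apply (Hd (w + h)), ball_of_Rabs. now replace (w + h - w) with h by ring. }
  apply Rle_lt_trans with (INR (S m) * Rabs (lens l m (w + h) - lens l m w)).
  2: { apply (Rmult_lt_compat_l (INR (S m))) in Hb; [|exact HS].
       replace (INR (S m) * (eps / INR (S m))) with eps in Hb by (field; lra). exact Hb. }
  apply Rmult_le_reg_l with (Rabs h); [now apply Rabs_pos_lt|].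
  rewrite <- Rabs_mult.
  replace (h * ((lens l (S m) (w + h) - lens l (S m) w) / h - - INR (S m) * lens l m w))
    with (lens l (S m) (w + h) - lens l (S m) w + INR (S m) * h * lens l m w)
    by (field; exact Hh0).
  destruct (Rle_lt_dec 0 h) as [H|H].
  - assert (B := lens_succ_diff_bounds l m w (w + h) ltac:(lra)).
    assert (D := lens_decr l m w (w + h) ltac:(lra)).
    rewrite (Rabs_pos_eq h) ?(Rabs_left1 (_ - _)) ?Rabs_pos_eq; lra.
  - assert (B := lens_succ_diff_bounds l m (w + h) w ltac:(lra)).
    assert (D := lens_decr l m (w + h) w ltac:(lra)).
    rewrite (Rabs_left1 h) ?(Rabs_pos_eq (lens l m (w + h) - _)) ?Rabs_pos_eq; lra.
Qed.

(** * The convolution *)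

(** Meant for integrands of compact support: once both limits lie beyond the support the integral is
    constant, and no limit has to be computed. *)
Lemma is_RInt_gen_near_const (f : R -> R) (Fa Fb : (R -> Prop) -> Prop)
  {FFa : Filter Fa} {FFb : Filter Fb} (v : R) :
  filter_prod Fa Fb (fun ab => is_RInt f (fst ab) (snd ab) v) ->
  is_RInt_gen f Fa Fb v.
Proof.
  intros H P HP. unfold filtermapi. apply: filter_imp H. intros ab Hab.
  exists v. split; [exact Hab | now apply locally_singleton].
Qed.

Lemma is_RInt_zero (f : R -> R) (a b : R) :
  (forall x, Rmin a b < x < Rmax a b -> f x = 0) -> is_RInt f a b 0.
Proof.
  intros H. apply (is_RInt_ext (fun _ => 0)); [intros x Hx; symmetry; auto|].
  assert (E := @is_RInt_const R_NormedModule a b 0).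
  unfold scal in E; simpl in E; unfold mult in E; simpl in E. now rewrite Rmult_0_r in E.
Qed.

Lemma f_ell_ge_1 (l : nat) (y : R) : 1 <= Rabs y -> f_ell l (Rabs y) = 0.
Proof.
  intros H. unfold f_ell. rewrite Rabs_Rabsolu. destruct (Rlt_dec _ _); lra.
Qed.

Lemma f_ell_lt_1 (l : nat) (y : R) : Rabs y < 1 -> f_ell l (Rabs y) = (1 - y ^ 2) ^ l.
Proof.
  intros H. unfold f_ell. rewrite Rabs_Rabsolu pow2_abs. destruct (Rlt_dec _ _); lra.
Qed.

Section Landen.
Variables (l : nat) (u : R).
Hypothesis Hu : 0 <= u < 1.

Let sigma (y : R) := sqrt (2 * (1 + u ^ 2) - (y - u) ^ 2).
Let Q (x : R) := (4 * ((1 - x ^ 2) * (x ^ 2 - u ^ 2))) ^ l.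

(** The minimum, attained at the ends where [|y - u| = 1 - u], is [(1 + u)^2]; hence [sigma] is
    smooth up to both ends. *)
Lemma landen_pos (y : R) : 2 * u - 1 <= y <= 1 -> 0 < 2 * (1 + u ^ 2) - (y - u) ^ 2.
Proof. intros Hy. nra. Qed.

(** From [s^2 + t^2 = 2 (1 + u^2)] comes [x^2 = (1 + u^2 + e t s) / 2], so [4 (1 - x^2) (x^2 - u^2)]
    is the difference of squares [(1 - u^2)^2 - t^2 s^2], from which the sign [e] has dropped
    out. *)
Lemma landen_pullback (e y : R) : e ^ 2 = 1 -> 2 * u - 1 <= y <= 1 ->
  Q ((sigma y + e * (y - u)) / 2) = ((1 - y ^ 2) * (1 - (2 * u - y) ^ 2)) ^ l.
Proof.
  intros He Hy. unfold Q. f_equal.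
  assert (Hs : sigma y ^ 2 = 2 * (1 + u ^ 2) - (y - u) ^ 2).
  { apply pow2_sqrt. assert (H := landen_pos y Hy). lra. }
  set (s := sigma y) in *. set (t := y - u) in *.
  replace (((s + e * t) / 2) ^ 2) with ((1 + u ^ 2 + e * (t * s)) / 2).
  2: { replace (((s + e * t) / 2) ^ 2) with ((s ^ 2 + e ^ 2 * t ^ 2 + 2 * (e * (t * s))) / 4)
         by field. rewrite Hs He. field. }
  transitivity ((1 - u ^ 2) ^ 2 - e ^ 2 * t ^ 2 * s ^ 2); [field|].
  rewrite Hs He. replace y with (t + u) by (unfold t; ring). ring.
Qed.

Lemma landen_substitution (e : R) : e ^ 2 = 1 ->
  is_RInt (fun y => (e - (y - u) / sigma y) / 2 * ((1 - y ^ 2) * (1 - (2 * u - y) ^ 2)) ^ l)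
    (2 * u - 1) 1
    (RInt Q ((sigma (2 * u - 1) + e * (2 * u - 1 - u)) / 2) ((sigma 1 + e * (1 - u)) / 2)).
Proof.
  intros He.
  assert (Hm : Rmin (2 * u - 1) 1 = 2 * u - 1) by (apply Rmin_left; lra).
  assert (HM : Rmax (2 * u - 1) 1 = 1) by (apply Rmax_right; lra).
  assert (C := is_RInt_comp Q (fun y => (sigma y + e * (y - u)) / 2)
    (fun y => (e - (y - u) / sigma y) / 2) (2 * u - 1) 1).
  apply: is_RInt_ext; [|apply C].
  - rewrite Hm HM. intros y Hy. unfold scal; simpl; unfold mult; simpl.
    rewrite landen_pullback; [reflexivity|exact He|lra].
  - intros y _. unfold Q. smooth.
  - rewrite Hm HM. intros y Hy. assert (P := landen_pos y Hy).
    assert (Ps : 0 < sigma y) by now apply sqrt_lt_R0.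
    assert (E : 2 * (1 + u * (u * 1)) + - ((y + - u) * ((y + - u) * 1))
                = 2 * (1 + u ^ 2) - (y - u) ^ 2) by ring.
    split.
    + unfold sigma. auto_derive; rewrite E; [exact P|]. fold (sigma y). field. lra.
    + unfold sigma. apply: ex_derive_continuous; auto_derive.
      rewrite E. fold (sigma y). repeat split; lra.
Qed.

(* The two substitutions [x = (sigma ± t) / 2] pull [Q] back to the same function
   of [t = y - u], and the difference of their derivatives is the constant [1]. *)
Lemma landen_integral :
  is_RInt (fun y => ((1 - y ^ 2) * (1 - (2 * u - y) ^ 2)) ^ l) (2 * u - 1) 1
    (2 * RInt Q u 1).
Proof.
  assert (S1 : sigma 1 = 1 + u).
  { unfold sigma. replace (_ - _) with ((1 + u) ^ 2) by ring. apply sqrt_pow2. lra. }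
  assert (S0 : sigma (2 * u - 1) = 1 + u).
  { unfold sigma. replace (_ - _) with ((1 + u) ^ 2) by ring. apply sqrt_pow2. lra. }
  assert (I1 := landen_substitution 1 ltac:(ring)).
  assert (I2 := landen_substitution (-1) ltac:(ring)).
  rewrite S0 S1 in I1. rewrite S0 S1 in I2.
  replace ((1 + u + 1 * (2 * u - 1 - u)) / 2) with u in I1 by field.
  replace ((1 + u + 1 * (1 - u)) / 2) with 1 in I1 by field.
  replace ((1 + u + -1 * (2 * u - 1 - u)) / 2) with 1 in I2 by field.
  replace ((1 + u + -1 * (1 - u)) / 2) with u in I2 by field.
  assert (I := is_RInt_minus _ _ _ _ _ _ I1 I2).
  (* The branch with [e = -1] runs from [1] down to [u]; subtracting it adds a second copy of the
     integral, hence the factor [2]. *)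
  replace (2 * RInt Q u 1) with (minus (RInt Q u 1) (RInt Q 1 u)).
  2: { rewrite -(opp_RInt_swap Q u 1).
       - unfold minus, opp, plus; simpl. ring.
       - apply: ex_RInt_continuous => x _. unfold Q. smooth. }
  apply: is_RInt_ext I. intros y Hy. unfold minus, opp, plus; simpl.
  rewrite Rmin_left in Hy; [|lra]. rewrite Rmax_right in Hy; [|lra].
  assert (P := sqrt_lt_R0 _ (landen_pos y ltac:(lra))). fold (sigma y) in P.
  field. lra.
Qed.
End Landen.

(** For [r < 2] the two supports meet in [[r - 1, 1]], the interval of [landen_integral] for
    [u = r / 2]. The constant collects [4^l] from [Q] and the factor [2] of the two branches. *)
Lemma conv_ff_lens (l : nat) (r : R) : 0 <= r ->
  conv_ff l r = 2 ^ (2 * l + 1) * lens l l (r ^ 2 / 4).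
Proof.
  intros Hr. unfold conv_ff.
  apply (@is_RInt_gen_unique R_CompleteNormedModule _ _
    (Proper_StrongProper _ (Rbar_locally_filter m_infty))
    (Proper_StrongProper _ (Rbar_locally_filter p_infty))).
  destruct (Rle_lt_dec 2 r) as [H|H].
  - rewrite lens_ge_1 ?Rmult_0_r; [|nra].
    apply (is_RInt_gen_near_const _ (Rbar_locally m_infty) (Rbar_locally p_infty)). apply filter_forall. intros ab.
    apply is_RInt_zero. intros y _.
    destruct (Rle_lt_dec 1 (Rabs y)) as [Hy|Hy].
    + rewrite f_ell_ge_1; [ring|exact Hy].
    + rewrite (f_ell_ge_1 l (r - y)); [ring|].
      apply Rabs_lt_between in Hy. rewrite Rabs_pos_eq; lra.
  - apply (is_RInt_gen_near_const _ (Rbar_locally m_infty) (Rbar_locally p_infty)).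
    exists (fun a => a < r - 1) (fun b => 1 < b); [now exists (r - 1) | now exists 1|].
    intros a b Ha Hb. simpl.
    set v := 2 ^ (2 * l + 1) * lens l l (r ^ 2 / 4).
    replace v with (0 + (v + 0)) by ring.
    apply: (is_RInt_Chasles (V := R_NormedModule) _ a (r - 1) b).
    { apply is_RInt_zero. intros y Hy. rewrite Rmin_left in Hy; [|lra].
      rewrite Rmax_right in Hy; [|lra].
      rewrite (f_ell_ge_1 l (r - y)); [ring|]. rewrite Rabs_pos_eq; lra. }
    apply: (is_RInt_Chasles (V := R_NormedModule) _ (r - 1) 1 b).
    2: { apply is_RInt_zero. intros y Hy. rewrite Rmin_left in Hy; [|lra].
      rewrite Rmax_right in Hy; [|lra].
      rewrite (f_ell_ge_1 l y); [ring|]. rewrite Rabs_pos_eq; lra. }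
    assert (I := landen_integral l (r / 2) ltac:(lra)).
    replace (2 * (r / 2) - 1) with (r - 1) in I by field.
    unfold v. replace (2 ^ (2 * l + 1) * lens l l (r ^ 2 / 4)) with
      (2 * RInt (fun x => (4 * ((1 - x ^ 2) * (x ^ 2 - (r / 2) ^ 2))) ^ l) (r / 2) 1).
    + apply: is_RInt_ext I. intros y Hy. rewrite Rmin_left in Hy; [|lra].
      rewrite Rmax_right in Hy; [|lra].
      rewrite !f_ell_lt_1; try (apply Rabs_def1; lra).
      rewrite Rpow_mult_distr. now replace (2 * (r / 2) - y) with (r - y) by field.
    + unfold lens. replace (r ^ 2 / 4) with ((r / 2) ^ 2) by field.
      rewrite sqrt_pow2; [|lra]. rewrite Rmin_right; [|lra].
      replace (2 ^ (2 * l + 1)) with (2 * 4 ^ l).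
      2: { rewrite pow_add pow_mult. replace (2 ^ 2) with 4 by ring. ring. }
      rewrite Rmult_assoc. f_equal.
      transitivity (RInt (fun x => scal (4 ^ l) ((1 - x ^ 2) ^ l * (x ^ 2 - (r / 2) ^ 2) ^ l))
        (r / 2) 1).
      * apply RInt_ext. intros x _. rewrite !Rpow_mult_distr. reflexivity.
      * apply: RInt_scal. apply ex_RInt_lens_integrand.
Qed.

(** * Derivatives of the f-form *)

(** The closed form of the f-form is known on [[0, oo)] only. A right derivative looks at no other
    values, so it may be read off from a function [G] that is differentiable on both sides, at [0]
    as well. *)
Lemma Dright_is_derive (g G : R -> R) (x d : R) :
  (forall y, x <= y -> g y = G y) -> is_derive G x d -> Dright g x = d.
Proof.
  intros Hg HG. apply (iota_filterlim_locally (V := R_CompleteNormedModule) (F := at_right 0)).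
  apply filterlim_locally. intros eps.
  apply is_derive_Reals in HG. destruct (HG eps (cond_pos eps)) as [del Hdel].
  exists del. intros h Hh Hpos.
  apply Rabs_of_ball in Hh. rewrite Rminus_0_r in Hh. apply ball_of_Rabs.
  rewrite (Hg (x + h)); [|lra]. rewrite (Hg x); [|lra]. apply Hdel; [lra|exact Hh].
Qed.

(** The factor [1 / 2] per step is the chain rule for [w = s / 2]; the exponents brought down by
    [lens_derive] multiply to [l! / (l - n)!]. *)
Lemma Dright_n_wu (l n : nat) (s : R) : (n <= l)%nat -> 0 <= s ->
  Dright_n n (Fform (conv_ff l)) s =
  (-1) ^ n * (2 ^ (2 * l + 1) / 2 ^ n * (INR (fact l) / INR (fact (l - n)))) *
  lens l (l - n) (s / 2).
Proof.
  revert s. induction n as [|n IH]; intros s Hn Hs.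
  - simpl Dright_n. unfold Fform. rewrite conv_ff_lens; [|apply sqrt_pos].
    rewrite pow2_sqrt; [|lra]. replace (2 * s / 4) with (s / 2) by field.
    rewrite Nat.sub_0_r. simpl. field. apply INR_fact_neq_0.
  - simpl Dright_n.
    set c := (-1) ^ n * (2 ^ (2 * l + 1) / 2 ^ n * (INR (fact l) / INR (fact (l - n)))).
    apply (Dright_is_derive _ (fun s => c * lens l (l - n) (s / 2))).
    { intros y Hy. apply IH; [lia|lra]. }
    replace (l - n)%nat with (S (l - S n)) by lia.
    assert (D := is_derive_comp (lens l (S (l - S n))) (fun s => s / 2) s _ (1 / 2)
      (lens_derive l (l - S n) (s / 2))).
    assert (D' : is_derive (fun s => s / 2) s (1 / 2)) by (auto_derive; auto; field).
    specialize (D D'). apply (is_derive_scal _ _ c) in D.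
    apply: (is_derive_ext _ _ _ _ (fun _ => Logic.eq_refl)).
    evar_last; [exact D|].
    transitivity (c * (1 / 2 * (- INR (S (l - S n)) * lens l (l - S n) (s / 2)))); [reflexivity|].
    unfold c.
    replace (l - n)%nat with (S (l - S n)) by lia.
    rewrite fact_simpl mult_INR. change ((-1) ^ S n) with (-1 * (-1) ^ n).
    change (2 ^ S n) with (2 * 2 ^ n).
    field. repeat split; try apply INR_fact_neq_0; try apply not_0_INR; try lia;
    apply pow_nonzero; lra.
Qed.

Lemma Ineg_nat_wu (l n : nat) (s : R) : (n <= l)%nat -> 0 <= s ->
  Ineg_nat n (Fform (conv_ff l)) s =
  2 ^ (2 * l + 1) / 2 ^ n * (INR (fact l) / INR (fact (l - n))) * lens l (l - n) (s / 2).
Proof.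
  intros Hn Hs. unfold Ineg_nat. rewrite Dright_n_wu; [|exact Hn|exact Hs].
  assert (E : (-1) ^ n * (-1) ^ n = 1).
  { rewrite -Rpow_mult_distr. replace (-1 * -1) with 1 by ring. apply pow1. }
  transitivity ((-1) ^ n * (-1) ^ n *
    (2 ^ (2 * l + 1) / 2 ^ n * (INR (fact l) / INR (fact (l - n))) * lens l (l - n) (s / 2)));
    [|rewrite E]; unfold Rdiv; ring.
Qed.

(** * The Gamma function *)

Definition gamma_integrand (x t : R) : R := Rpower t (x - 1) * exp (- t).

(** [Gamma] is the value selected for an improper integral and says something only once that
    integral converges; this relation carries the convergence along. *)
Definition is_Gamma (x g : R) : Prop :=
  is_RInt_gen (gamma_integrand x) (at_right 0) (Rbar_locally p_infty) g.

Lemma is_Gamma_unique (x g : R) : is_Gamma x g -> Gamma x = g.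
Proof. intros H.
  exact (@is_RInt_gen_unique R_CompleteNormedModule _ _
    (Proper_StrongProper _ (at_right_proper_filter 0))
    (Proper_StrongProper _ (Rbar_locally_filter p_infty)) _ g H). Qed.

Lemma gamma_integrand_continuous (x t : R) : 0 < t -> continuous (gamma_integrand x) t.
Proof. intros H. unfold gamma_integrand, Rpower. apply: ex_derive_continuous. auto_derive. exact H. Qed.

Lemma gamma_integrand_pos (x t : R) : 0 < gamma_integrand x t.
Proof. apply Rmult_lt_0_compat; apply exp_pos. Qed.

Lemma ex_RInt_gamma_integrand (x a b : R) : 0 < a -> a <= b -> ex_RInt (gamma_integrand x) a b.
Proof.
  intros Ha Hb. apply: ex_RInt_continuous => t. rewrite Rmin_left; [|lra]. intros Ht.
  apply gamma_integrand_continuous. lra.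
Qed.

Lemma Rpower_lim_0 (x : R) : 0 < x -> filterlim (fun t => Rpower t x) (at_right 0) (locally 0).
Proof.
  intros Hx. apply filterlim_locally. intros eps.
  exists (mkposreal (Rpower eps (/ x)) (exp_pos _)). intros t Ht Hpos.
  apply Rabs_of_ball in Ht. apply ball_of_Rabs. simpl in Ht. rewrite Rminus_0_r in Ht. rewrite Rminus_0_r.
  rewrite Rabs_pos_eq in Ht; [|lra]. rewrite Rabs_pos_eq; [|left; apply exp_pos].
  replace (pos eps) with (Rpower (Rpower eps (/ x)) x).
  - now apply Rlt_Rpower_l.
  - rewrite Rpower_mult Rinv_l; [|lra]. apply Rpower_1, cond_pos.
Qed.

Lemma Rpower_derive (a t : R) : 0 < t -> is_derive (fun t => Rpower t a) t (a * Rpower t (a - 1)).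
Proof.
  intros Ht. unfold Rpower. auto_derive; [exact Ht|].
  replace ((a - 1) * ln t) with (a * ln t + - ln t) by ring.
  rewrite exp_plus exp_Ropp exp_ln; [|exact Ht]. field. lra.
Qed.

Lemma RInt_Rpower_le (x a : R) : 0 < x -> 0 < a <= 1 ->
  RInt (fun t => Rpower t (x - 1)) a 1 <= / x.
Proof.
  intros Hx Ha.
  assert (I : is_RInt (fun t => Rpower t (x - 1)) a 1
    (minus (/ x * Rpower 1 x) (/ x * Rpower a x))).
  { apply: (is_RInt_derive (V := R_CompleteNormedModule) (fun t => / x * Rpower t x)).
    - rewrite Rmin_left; [|lra]. intros t Ht.
      evar_last; [apply is_derive_scal, Rpower_derive; lra|]. field. lra.
    - rewrite Rmin_left; [|lra]. intros t Ht. unfold Rpower.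
      apply: ex_derive_continuous. auto_derive. lra. }
  rewrite (is_RInt_unique _ _ _ _ I). unfold minus, plus, opp; simpl.
  rewrite /Rpower ln_1 Rmult_0_r exp_0.
  assert (0 < / x * exp (x * ln a))
    by (apply Rmult_lt_0_compat; [apply Rinv_0_lt_compat; lra|apply exp_pos]).
  lra.
Qed.

Lemma RInt_exp_le (b : R) : 1 <= b -> RInt (fun t => exp (- t)) 1 b <= 1.
Proof.
  intros Hb.
  assert (I : is_RInt (fun t => exp (- t)) 1 b (minus (- exp (- b)) (- exp (- 1)))).
  { apply: (is_RInt_derive (V := R_CompleteNormedModule) (fun t => - exp (- t))).
    - intros t _. auto_derive; auto. ring.
    - intros t _. smooth. }
  rewrite (is_RInt_unique _ _ _ _ I). unfold minus, plus, opp; simpl.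
  assert (H := exp_pos (- b)). assert (H1 := exp_increasing (-1) 0 ltac:(lra)).
  rewrite exp_0 in H1. lra.
Qed.

(** Below [1] the exponential is dropped, above [1] the power, which is at most [1] there because
    [x <= 1]. *)
Lemma gamma_integrand_RInt_bound (x a b : R) : 0 < x <= 1 -> 0 < a <= 1 -> 1 <= b ->
  RInt (gamma_integrand x) a b <= / x + 1.
Proof.
  intros Hx Ha Hb.
  assert (Ch : RInt (gamma_integrand x) a b =
    RInt (gamma_integrand x) a 1 + RInt (gamma_integrand x) 1 b).
  { symmetry. apply: RInt_Chasles; apply ex_RInt_gamma_integrand; lra. }
  rewrite Ch. apply Rplus_le_compat.
  - apply: Rle_trans; [|apply (RInt_Rpower_le x a); lra].
    apply RInt_le; [lra|apply ex_RInt_gamma_integrand; lra| |].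
    + apply: ex_RInt_continuous => t. rewrite Rmin_left; [|lra]. intros Ht. unfold Rpower.
      apply: ex_derive_continuous. auto_derive. lra.
    + intros t Ht. rewrite -[X in _ <= X]Rmult_1_r. apply Rmult_le_compat_l.
      * left; apply exp_pos.
      * rewrite -exp_0. left. apply exp_increasing. lra.
  - apply: Rle_trans; [|apply (RInt_exp_le b); lra].
    apply RInt_le; [lra|apply ex_RInt_gamma_integrand; lra| |].
    + apply: ex_RInt_continuous => t _. smooth.
    + intros t Ht. rewrite -[X in _ <= X]Rmult_1_l. apply Rmult_le_compat_r.
      * left; apply exp_pos.
      * rewrite -[X in _ <= X](Rpower_O t); [|lra]. apply Rle_Rpower; lra.
Qed.

Lemma gamma_integrand_RInt_mono (x a a' b b' : R) : 0 < a' <= a -> a <= b <= b' ->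
  RInt (gamma_integrand x) a b <= RInt (gamma_integrand x) a' b'.
Proof.
  intros Ha Hb.
  assert (Ch : RInt (gamma_integrand x) a' b' =
    RInt (gamma_integrand x) a' a + (RInt (gamma_integrand x) a b + RInt (gamma_integrand x) b b')).
  { symmetry. rewrite -(RInt_Chasles (V := R_CompleteNormedModule) _ a' a b');
      try (apply ex_RInt_gamma_integrand; lra).
    rewrite -(RInt_Chasles (V := R_CompleteNormedModule) _ a b b');
      try (apply ex_RInt_gamma_integrand; lra). reflexivity. }
  assert (P : forall c d, 0 < c -> c <= d -> 0 <= RInt (gamma_integrand x) c d).
  { intros c d Hc Hd. apply RInt_ge_0; [lra|apply ex_RInt_gamma_integrand; lra|].
    intros; left; apply gamma_integrand_pos. }
  assert (P1 := P a' a ltac:(lra) ltac:(lra)). assert (P2 := P b b' ltac:(lra) ltac:(lra)). lra.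
Qed.

(** The integrand is positive, so the truncated integrals grow with the interval and their supremum
    is the improper integral. The range [(0, 1]] covers the order [nu] of the fractional
    integration; positivity of the value allows division by it. *)
Lemma is_Gamma_exists_small (x : R) : 0 < x <= 1 -> exists g, is_Gamma x g /\ 0 < g.
Proof.
  intros Hx.
  set (E := fun y => exists a b, 0 < a <= 1 /\ 1 <= b /\ y = RInt (gamma_integrand x) a b).
  destruct (completeness E) as [g [Hub Hlub]].
  - exists (/ x + 1). intros y [a [b [Ha [Hb ->]]]]. now apply gamma_integrand_RInt_bound.
  - exists (RInt (gamma_integrand x) 1 1), 1, 1. repeat split; lra.
  - exists g. split.
    2: { apply Rlt_le_trans with (RInt (gamma_integrand x) 1 2).
         - apply RInt_gt_0; [lra|intros; apply gamma_integrand_pos|].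
           intros t Ht. apply gamma_integrand_continuous. lra.
         - apply Hub. exists 1, 2. repeat split; lra. }
    intros P [eps HP].
    assert (Hex : exists a b, 0 < a <= 1 /\ 1 <= b /\ g - eps < RInt (gamma_integrand x) a b).
    { apply Classical_Prop.NNPP. intros Hn.
      assert (Hb : is_upper_bound E (g - eps)).
      { intros y [a [b [Ha [Hb ->]]]]. apply Rnot_lt_le. intros Hlt. apply Hn.
        exists a, b. auto. }
      specialize (Hlub _ Hb). assert (H := cond_pos eps). lra. }
    destruct Hex as [a [b [Ha [Hb Hab]]]].
    exists (fun t => 0 < t < a) (fun t => b < t).
    { exists (mkposreal a (proj1 Ha)). intros t Ht Hp.
      apply Rabs_of_ball in Ht. simpl in Ht. rewrite Rminus_0_r in Ht. rewrite Rabs_pos_eq in Ht; lra. }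
    { now exists b. }
    intros a' b' Ha' Hb'. simpl. exists (RInt (gamma_integrand x) a' b'). split.
    + apply: RInt_correct. apply ex_RInt_gamma_integrand; lra.
    + apply HP, ball_of_Rabs.
      assert (M := gamma_integrand_RInt_mono x a a' b b' ltac:(lra) ltac:(lra)).
      assert (U : RInt (gamma_integrand x) a' b' <= g).
      { apply Hub. exists a', b'. repeat split; lra. }
      assert (Hp := cond_pos eps). apply Rabs_def1; lra.
Qed.

Lemma Rpower_exp_lim_p_infty (x : R) :
  filterlim (fun t => Rpower t x * exp (- t)) (Rbar_locally p_infty) (locally 0).
Proof.
  (* The product is the exponential of [t (x ln t / t - 1)], whose second factor tends to [-1]. *)
  assert (L : is_lim (fun t => exp (t * (x * (ln t / t) - 1))) p_infty 0).
  { apply (is_lim_comp exp (fun t => t * (x * (ln t / t) - 1)) p_infty 0 m_infty).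
    - exact is_lim_exp_m.
    - evar_last; [apply (is_lim_mult (fun t => t) (fun t => x * (ln t / t) - 1) p_infty p_infty (-1))|].
      + apply is_lim_id.
      + evar_last; [apply: (is_lim_minus _ _ _ (x * 0) 1 (-1))|reflexivity].
        * apply (is_lim_scal_l _ x p_infty 0), is_lim_div_ln_p.
        * apply is_lim_const.
        * unfold is_Rbar_minus, is_Rbar_plus; simpl. do 2 f_equal. ring.
      + simpl. lra.
      + apply is_Rbar_mult_unique, is_Rbar_mult_p_infty_neg. simpl. lra.
    - exists 0. intros; discriminate. }
  apply: filterlim_ext_loc L. exists 0. intros t Ht.
  unfold Rpower. rewrite -exp_plus. f_equal. field. lra.
Qed.

(** Integration by parts: [F = t^x exp (-t)] tends to [0] at both ends, so [F' = x * gamma_integrand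
    x - gamma_integrand (x + 1)] has integral [0]. *)
Lemma is_Gamma_succ (x g : R) : 0 < x -> is_Gamma x g -> is_Gamma (x + 1) (x * g).
Proof.
  intros Hx Hg.
  set (F := fun t => Rpower t x * exp (- t)).
  assert (dF : forall t, 0 < t ->
    is_derive F t (x * gamma_integrand x t - gamma_integrand (x + 1) t)).
  { intros t Ht. unfold F.
    evar_last; [apply (is_derive_mult (fun t => Rpower t x) (fun t => exp (- t)) t
      (x * Rpower t (x - 1)) (- exp (- t)))|].
    - now apply Rpower_derive.
    - auto_derive; auto. ring.
    - intros; apply Rmult_comm.
    - unfold gamma_integrand, plus, mult; simpl. replace (x + 1 - 1) with x by ring. ring. }
  assert (F0 : filterlim F (at_right 0) (locally 0)).
  { replace 0 with (0 * 1) at 2 by ring.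
    apply: (filterlim_comp_2 (G := locally 0) (H := locally 1)).
    - now apply Rpower_lim_0.
    - assert (C : continuous (fun t => exp (- t)) 0) by smooth.
      unfold continuous in C. rewrite Ropp_0 exp_0 in C.
      apply: filterlim_filter_le_1 C. apply filter_le_within.
    - apply (filterlim_mult (K := R_AbsRing) 0 1). }
  assert (Fp : filterlim F (Rbar_locally p_infty) (locally 0)) by apply Rpower_exp_lim_p_infty.
  assert (I : is_RInt_gen (Derive F) (at_right 0) (Rbar_locally p_infty) (0 - 0)).
  { assert (P : forall Q : R -> Prop, (forall t, 0 < t -> Q t) ->
      filter_prod (at_right 0) (Rbar_locally p_infty) (fun ab =>
        forall t, Rmin (fst ab) (snd ab) <= t <= Rmax (fst ab) (snd ab) -> Q t)).
    { intros Q HQ. exists (fun t => 0 < t) (fun t => 0 < t).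
      - exists (mkposreal 1 Rlt_0_1). auto.
      - now exists 0.
      - intros a b Ha Hb t Ht. apply HQ. simpl in Ht.
        apply Rlt_le_trans with (2 := proj1 Ht). now apply Rmin_pos. }
    apply is_RInt_gen_Derive; auto; try apply _.
    - apply P. intros t Ht. eexists. now apply dF.
    - apply P. intros t Ht.
      apply (continuous_ext_loc _ (fun t => x * gamma_integrand x t - gamma_integrand (x + 1) t)).
      + exists (mkposreal t Ht). intros s Hs.
        apply Rabs_of_ball, Rabs_def2 in Hs. simpl in Hs. symmetry. apply is_derive_unique, dF. lra.
      + apply: (continuous_minus (V := R_NormedModule)).
        * apply: (continuous_scal_r (V := R_NormedModule)). now apply gamma_integrand_continuous.
        * now apply gamma_integrand_continuous. }
  assert (I2 := is_RInt_gen_minus _ _ _ _ (is_RInt_gen_scal _ x _ Hg) I).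
  replace (x * g) with (minus (scal x g) (0 - 0)).
  2: { unfold minus, scal, plus, opp; simpl; unfold mult; simpl. ring. }
  apply: is_RInt_gen_ext I2. exists (fun t => 0 < t) (fun t => 0 < t).
  - exists (mkposreal 1 Rlt_0_1). auto.
  - now exists 0.
  - intros a b Ha Hb t Ht. simpl in Ht.
    assert (Ht0 : 0 < t) by (apply Rlt_trans with (2 := proj1 Ht); now apply Rmin_pos).
    rewrite (is_derive_unique _ _ _ (dF t Ht0)).
    unfold minus, scal, plus, opp; simpl; unfold mult; simpl. ring.
Qed.

(** Turns [Gamma (nu + m + 1) / Gamma nu] into a Pochhammer symbol, the shape in which the Beta
    integrals deliver it. *)
Lemma is_Gamma_poch (x g : R) (n : nat) : 0 < x -> is_Gamma x g -> is_Gamma (x + INR n) (g * poch x n).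
Proof.
  intros Hx Hg. induction n as [|n IH].
  - simpl. now rewrite Rplus_0_r Rmult_1_r.
  - rewrite S_INR -Rplus_assoc. simpl poch.
    replace (g * (poch x n * (x + INR n))) with ((x + INR n) * (g * poch x n)) by ring.
    apply is_Gamma_succ; [|exact IH]. assert (H := pos_INR n). lra.
Qed.

Lemma is_Gamma_1 : is_Gamma 1 1.
Proof.
  assert (F0 : filterlim (fun t => - exp (- t)) (at_right 0) (locally (- 1))).
  { assert (C : continuous (fun t => - exp (- t)) 0) by smooth.
    unfold continuous in C. rewrite Ropp_0 exp_0 in C.
    apply: filterlim_filter_le_1 C. apply filter_le_within. }
  assert (Fp : filterlim (fun t => - exp (- t)) (Rbar_locally p_infty) (locally 0)).
  { assert (H := Rpower_exp_lim_p_infty 0).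
    assert (H1 : is_lim (fun t => - (Rpower t 0 * exp (- t))) p_infty (- 0)).
    { apply (is_lim_opp _ _ 0), H. }
    rewrite Ropp_0 in H1. apply: filterlim_ext_loc H1. exists 0. intros t Ht.
    rewrite Rpower_O; [ring|exact Ht]. }
  assert (dF : forall t, is_derive (fun t => - exp (- t)) t (exp (- t)))
    by (intros t; auto_derive; auto; ring).
  assert (I : is_RInt_gen (Derive (fun t => - exp (- t))) (at_right 0) (Rbar_locally p_infty)
    (0 - - 1)).
  { apply is_RInt_gen_Derive; auto; try apply _; apply filter_forall; intros ab t _.
    - eexists. apply dF.
    - apply (continuous_ext (fun t => exp (- t))); [|smooth].
      intros s. symmetry. apply is_derive_unique, dF. }
  replace (0 - - 1) with 1 in I by ring.
  apply: is_RInt_gen_ext I. exists (fun t => 0 < t) (fun t => 0 < t).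
  - exists (mkposreal 1 Rlt_0_1). auto.
  - now exists 0.
  - intros a b Ha Hb t Ht. simpl in Ht.
    assert (Ht0 : 0 < t) by (apply Rlt_trans with (2 := proj1 Ht); now apply Rmin_pos).
    rewrite (is_derive_unique _ _ _ (dF t)). unfold gamma_integrand.
    rewrite Rminus_diag Rpower_O; [now rewrite Rmult_1_l|exact Ht0].
Qed.

(** * Pochhammer symbols and the binomial series *)

Lemma poch_shift (a : R) (n : nat) : poch a (S n) = a * poch (a + 1) n.
Proof.
  induction n as [|n IH]; [simpl; ring|].
  change (poch a (S (S n))) with (poch a (S n) * (a + INR (S n))).
  rewrite IH S_INR. simpl. ring.
Qed.

Lemma poch_pos (a : R) (n : nat) : 0 < a -> 0 < poch a n.
Proof.
  intros Ha. induction n as [|n IH]; simpl; [lra|].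
  apply Rmult_lt_0_compat; [exact IH|]. assert (H := pos_INR n). lra.
Qed.

Lemma poch_1_fact (n : nat) : poch 1 n = INR (fact n).
Proof.
  induction n as [|n IH]; [reflexivity|].
  rewrite fact_simpl mult_INR S_INR -IH. simpl. ring.
Qed.

(** A Wallis-type bound, squared to stay rational; the induction step amounts to
    [(2n + 1) (2n + 3) <= (2n + 2)^2]. *)
Lemma poch_half_fact_bound (n : nat) : (poch (1 / 2) n / INR (fact n)) ^ 2 * (2 * INR n + 1) <= 1.
Proof.
  induction n as [|n IH]; [simpl; lra|].
  rewrite fact_simpl mult_INR. rewrite S_INR. simpl poch.
  assert (Hn := pos_INR n). assert (Hf := INR_fact_lt_0 n).
  set q := poch (1 / 2) n / INR (fact n) in IH.
  replace (poch (1 / 2) n * (1 / 2 + INR n) / ((INR n + 1) * INR (fact n)))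
    with (q * ((2 * INR n + 1) / (2 * (INR n + 1)))) by (unfold q; field; lra).
  apply: Rle_trans; [|exact IH].
  rewrite Rpow_mult_distr Rmult_assoc. apply Rmult_le_compat_l; [apply pow2_ge_0|].
  apply Rmult_le_reg_r with ((2 * (INR n + 1)) ^ 2); [nra|].
  apply Rle_trans with ((2 * INR n + 1) ^ 2 * (2 * (INR n + 1) + 1)); [right; field; lra|].
  nra.
Qed.

Lemma is_lim_seq_inv_succ : is_lim_seq (fun n => / (INR n + 1)) 0.
Proof.
  apply (is_lim_seq_ext (fun n => / INR (S n))); [intros n; now rewrite S_INR|].
  apply (is_lim_seq_incr_1 (fun n => / INR n)).
  apply (is_lim_seq_inv _ p_infty); [apply is_lim_seq_INR|discriminate].
Qed.

(** These numbers are the partial sums at [z = 1] of the binomial series of [(1 - z)^(n + 1/2)], so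
    the limit [0] is convergence at the boundary point. The Wallis-type bound gives [n = 0]; each
    further [n] gains a factor of order [1 / (N + 1)]. *)
Lemma is_lim_seq_poch_half_fact (n : nat) :
  is_lim_seq (fun N => poch (1 / 2 - INR n) N / INR (fact N)) 0.
Proof.
  induction n as [|n IH].
  - rewrite Rminus_0_r.
    apply (is_lim_seq_le_le (fun _ => 0) _ (fun N => sqrt (/ (INR N + 1)))).
    + intros N. assert (H := poch_half_fact_bound N). assert (HN := pos_INR N).
      assert (Hq : 0 < poch (1 / 2) N / INR (fact N)).
      { apply Rdiv_lt_0_compat; [apply poch_pos; lra|apply INR_fact_lt_0]. }
      split; [lra|]. set q := poch (1 / 2) N / INR (fact N) in H Hq |- *.
      rewrite -(sqrt_pow2 q); [|lra]. apply sqrt_le_1_alt.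
      apply Rmult_le_reg_r with (INR N + 1); [lra|]. rewrite Rinv_l; nra.
    + apply is_lim_seq_const.
    + replace 0 with (sqrt 0) by apply sqrt_0.
      apply is_lim_seq_continuous; [apply continuity_pt_sqrt; lra|apply is_lim_seq_inv_succ].
  - apply is_lim_seq_incr_1.
    apply (is_lim_seq_ext (fun N => (1 / 2 - INR (S n)) *
      ((poch (1 / 2 - INR n) N / INR (fact N)) * / (INR N + 1)))).
    + intros N. rewrite poch_shift fact_simpl mult_INR.
      replace (1 / 2 - INR (S n) + 1) with (1 / 2 - INR n) by (rewrite S_INR; ring).
      rewrite (S_INR N). field. split; [apply INR_fact_neq_0|].
      assert (H := pos_INR N). lra.
    + replace 0 with ((1 / 2 - INR (S n)) * (0 * 0)) by ring.
      apply (is_lim_seq_scal_l _ _ (0 * 0)).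
      apply is_lim_seq_mult'; [exact IH|apply is_lim_seq_inv_succ].
Qed.

Section Binomial.
Variable n : nat.
Let a := - INR n - 1 / 2.
Let p := INR n + 1 / 2.
Let t (j : nat) := poch a j / INR (fact j).
Let T (N : nat) (z : R) := sum_f_R0 (fun j => t j * z ^ j) N.

(** The function [(1 - z)^p] solves [(1 - z) y' = a y]. Truncating its series spoils the equation by
    the single top term, all other powers cancelling. *)
Lemma binomial_partial_sum_derive (N : nat) (z : R) :
  exists d, is_derive (T N) z d /\ (1 - z) * d = a * T N z - (a + INR N) * t N * z ^ N.
Proof.
  induction N as [|N [d [Hd E]]].
  - exists 0. split.
    + apply (is_derive_ext (fun _ => t 0%nat)); [|apply (is_derive_const (V := R_NormedModule))].
      intros x. unfold T. simpl. ring.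
    + unfold T, t. simpl. field.
  - exists (d + t (S N) * (INR (S N) * z ^ N)). split.
    + apply (is_derive_plus (V := R_NormedModule)); [exact Hd|].
      auto_derive; [exact I|]. rewrite !Rmult_1_l. reflexivity.
    + unfold T in *. rewrite tech5. rewrite (Rmult_plus_distr_l (1 - z)) E.
      assert (Ht : t (S N) * INR (S N) = (a + INR N) * t N).
      { unfold t. rewrite fact_simpl mult_INR. simpl poch. field.
        split; [apply INR_fact_neq_0|apply not_0_INR; lia]. }
      change (z ^ S N) with (z * z ^ N).
      rewrite -Ht S_INR. ring.
Qed.

Lemma sqrt_pow_Rpower (x : R) : 0 < x -> sqrt x ^ (2 * n + 1) = Rpower x p.
Proof.
  intros Hx. rewrite -Rpower_pow; [|now apply sqrt_lt_R0].
  rewrite -Rpower_sqrt; [|exact Hx]. rewrite Rpower_mult. f_equal.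
  unfold p. rewrite plus_INR mult_INR. simpl. field.
Qed.

(** [(1 - z)^a] is an integrating factor: the derivative of [T N z (1 - z)^a] is
    [- c z^N (1 - z)^(a - 1)], dominated on [[0, 1)] by that of [(|c| / p) (1 - z)^a]. Comparing
    increments from [0] and multiplying by [(1 - z)^p] bounds the error by
    [(|c| / p) (1 - (1 - z)^p)], hence by its value [|c| / p] at [z = 1]. *)
Lemma binomial_remainder (N : nat) (z : R) : 0 <= z <= 1 ->
  Rabs (sqrt (1 - z) ^ (2 * n + 1) - T N z) <= Rabs (poch (1 / 2 - INR n) N / INR (fact N)).
Proof.
  intros Hz. assert (Hp : 0 < p) by (unfold p; assert (H := pos_INR n); lra).
  assert (Hap : a = - p) by (unfold a, p; ring).
  set c := (a + INR N) * t N.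
  assert (HK : Rabs (poch (1 / 2 - INR n) N / INR (fact N)) = Rabs c / p).
  { unfold c, t. replace ((a + INR N) * (poch a N / INR (fact N)))
      with (poch a (S N) / INR (fact N)) by (simpl; field; apply INR_fact_neq_0).
    rewrite poch_shift. replace (a + 1) with (1 / 2 - INR n) by (unfold a; field).
    set q := poch (1 / 2 - INR n) N / INR (fact N).
    replace (a * poch (1 / 2 - INR n) N / INR (fact N)) with (- p * q)
      by (unfold q; rewrite Hap; field; apply INR_fact_neq_0).
    rewrite Rabs_mult Rabs_Ropp (Rabs_pos_eq p); [|lra]. field. lra. }
  rewrite HK.
  destruct (Req_dec z 1) as [->|Hz1].
  - rewrite Rminus_diag sqrt_0 pow_i; [|lia].
    (* At [z = 1] the left side of the differential equation is [0], which gives [T N 1 = c / a]. *)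
    destruct (binomial_partial_sum_derive N 1) as [d [_ E]].
    rewrite Rminus_diag Rmult_0_l pow1 Rmult_1_r in E. fold c in E.
    replace (0 - T N 1) with (c / p).
    + unfold Rdiv. rewrite Rabs_mult (Rabs_pos_eq (/ p)); [lra|]. left. now apply Rinv_0_lt_compat.
    + rewrite Hap in E. apply (Rmult_eq_reg_r p); [|lra]. field_simplify; lra.
  - assert (Hlt : 0 < 1 - z) by lra. rewrite sqrt_pow_Rpower; [|exact Hlt].
    assert (dA : forall y, y < 1 ->
      is_derive (fun y => Rpower (1 - y) a) y (p * Rpower (1 - y) (a - 1))).
    { intros y Hy. evar_last.
      - apply (is_derive_comp (fun y => Rpower y a) (fun y => 1 - y)).
        + apply Rpower_derive. lra.
        + auto_derive; auto.
      - unfold scal; simpl; unfold mult; simpl. rewrite Hap. ring. }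
    (* [Phi] has nonpositive derivative for either sign [e]; the two signs together give the
       absolute value. *)
    assert (Key : forall e, Rabs e = 1 ->
      e * (T N z * Rpower (1 - z) a - 1) <= Rabs c * ((Rpower (1 - z) a - 1) / p)).
    { intros e He.
      set Phi := fun y => e * (T N y * Rpower (1 - y) a) - Rabs c / p * Rpower (1 - y) a.
      destruct (MVT_gen Phi 0 z
        (fun y => Rpower (1 - y) (a - 1) * (- (e * c * y ^ N) - Rabs c))) as [y [Hy E]].
      - rewrite Rmin_left; [|lra]. rewrite Rmax_right; [|lra]. intros y Hy.
        destruct (binomial_partial_sum_derive N y) as [d [Hd E]].
        unfold Phi. evar_last.
        + apply: (is_derive_minus (V := R_NormedModule)).
          * apply is_derive_scal, (is_derive_mult (T N) (fun y => Rpower (1 - y) a) y);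
              [exact Hd|apply dA; lra|intros; apply Rmult_comm].
          * apply is_derive_scal, dA. lra.
        + unfold minus, plus, opp, mult; simpl.
          replace (Rpower (1 - y) a) with ((1 - y) * Rpower (1 - y) (a - 1)).
          2: { rewrite -{1}(Rpower_1 (1 - y)); [|lra]. rewrite -Rpower_plus. f_equal. ring. }
          fold c in E.
          transitivity (Rpower (1 - y) (a - 1) * (e * ((1 - y) * d + p * T N y) - Rabs c)).
          * field. lra.
          * rewrite E Hap. ring.
      - rewrite Rmin_left; [|lra]. rewrite Rmax_right; [|lra]. intros y Hy.
        apply continuity_pt_filterlim. apply: ex_derive_continuous.
        destruct (binomial_partial_sum_derive N y) as [d [Hd _]].
        unfold Phi. eexists. apply: (is_derive_minus (V := R_NormedModule)).
          * apply is_derive_scal, (is_derive_mult (T N) (fun y => Rpower (1 - y) a) y);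
              [exact Hd|apply dA; lra|intros; apply Rmult_comm].
          * apply is_derive_scal, dA. lra.
      - rewrite Rmin_left in Hy; [|lra]. rewrite Rmax_right in Hy; [|lra].
        assert (Hneg : Rpower (1 - y) (a - 1) * (- (e * c * y ^ N) - Rabs c) <= 0).
        { assert (0 < Rpower (1 - y) (a - 1)) by apply exp_pos.
          assert (Rabs (e * c * y ^ N) <= Rabs c).
          { rewrite (Rabs_mult (e * c)) (Rabs_mult e c) He Rmult_1_l -[X in _ <= X]Rmult_1_r.
            apply Rmult_le_compat_l; [apply Rabs_pos|].
            rewrite Rabs_pos_eq; [|apply pow_le; lra]. rewrite -[X in _ <= X](pow1 N).
            apply pow_incr. lra. }
          apply Rabs_le_between in H0. nra. }
        assert (T0 : T N 0 = 1).
        { unfold T. clear. induction N as [|N IH]; [unfold t; simpl; field|].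
          rewrite tech5 IH pow_i; [|lia]. ring. }
        assert (E0 : Phi 0 = e - Rabs c / p).
        { unfold Phi. rewrite T0 Rminus_0_r. rewrite /Rpower ln_1 Rmult_0_r exp_0. ring. }
        rewrite E0 Rminus_0_r in E. unfold Phi in E.
        assert (Rpower (1 - y) (a - 1) * (- (e * c * y ^ N) - Rabs c) * z <= 0) by nra.
        unfold Rdiv in *. nra. }
    assert (K1 := Key 1 Rabs_R1).
    assert (K2 := Key (-1) ltac:(rewrite Rabs_Ropp; apply Rabs_R1)).
    set A := Rpower (1 - z) a in K1 K2. set Bz := Rpower (1 - z) p.
    assert (HAB : A * Bz = 1).
    { unfold A, Bz. rewrite -Rpower_plus Hap. replace (- p + p) with 0 by ring.
      now apply Rpower_O. }
    assert (HB : 0 < Bz) by apply exp_pos.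
    assert (Hc : 0 <= Rabs c / p).
    { apply Rdiv_le_0_compat; [apply Rabs_pos|lra]. }
    replace (Rabs c * ((A - 1) / p)) with (Rabs c / p * (A - 1)) in K1, K2 by (field; lra).
    apply (Rmult_le_compat_r Bz) in K1; [|lra]. apply (Rmult_le_compat_r Bz) in K2; [|lra].
    replace (1 * (T N z * A - 1) * Bz) with (T N z * (A * Bz) - Bz) in K1 by ring.
    replace (-1 * (T N z * A - 1) * Bz) with (Bz - T N z * (A * Bz)) in K2 by ring.
    replace (Rabs c / p * (A - 1) * Bz) with (Rabs c / p * (A * Bz - Bz)) in K1, K2 by ring.
    rewrite HAB in K1. rewrite HAB in K2.
    apply Rabs_le. nra.
Qed.
End Binomial.

(** * Uniformly convergent expansions *)

(** One [e N] serves the whole of [[0, 1]], the point [z = 1] included. The offset [m] is kept apart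
    from the index so that integration raises [m] and merely rescales [b]. *)
Definition unif_pseries (h : R -> R) (m : nat) (b : nat -> R) : Prop :=
  exists e : nat -> R, is_lim_seq e 0 /\
    forall N z, 0 <= z <= 1 -> Rabs (h z - sum_f_R0 (fun j => b j * z ^ (m + j)) N) <= e N.

Lemma unif_pseries_ext (h h' : R -> R) (m : nat) (b b' : nat -> R) :
  (forall z, 0 <= z <= 1 -> h z = h' z) -> (forall j, b j = b' j) ->
  unif_pseries h m b -> unif_pseries h' m b'.
Proof.
  intros Hh Hb [e [He H]]. exists e. split; [exact He|]. intros N z Hz.
  rewrite -Hh; [|exact Hz].
  rewrite -(sum_eq (fun j => b j * z ^ (m + j))); [now apply H|].
  intros i _. now rewrite Hb.
Qed.

Lemma unif_pseries_lin (h1 h2 : R -> R) (m : nat) (b1 b2 : nat -> R) (c : R) :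
  unif_pseries h1 m b1 -> unif_pseries h2 m b2 ->
  unif_pseries (fun z => h1 z + c * h2 z) m (fun j => b1 j + c * b2 j).
Proof.
  intros [e1 [He1 H1]] [e2 [He2 H2]]. exists (fun N => e1 N + Rabs c * e2 N). split.
  - replace 0 with (0 + Rabs c * 0) by ring. apply is_lim_seq_plus'; [exact He1|].
    now apply (is_lim_seq_scal_l _ _ 0).
  - intros N z Hz. specialize (H1 N z Hz). specialize (H2 N z Hz).
    replace (sum_f_R0 _ N) with (sum_f_R0 (fun j => b1 j * z ^ (m + j)) N +
      c * sum_f_R0 (fun j => b2 j * z ^ (m + j)) N).
    2: { rewrite scal_sum -plus_sum. apply sum_eq. intros; ring. }
    set S1 := sum_f_R0 _ N. set S2 := sum_f_R0 _ N in H2 |- *.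
    replace (_ - _) with ((h1 z - S1) + c * (h2 z - S2)) by ring.
    apply: Rle_trans; [apply Rabs_triang|]. rewrite Rabs_mult.
    apply Rplus_le_compat; [exact H1|]. apply Rmult_le_compat_l; [apply Rabs_pos|exact H2].
Qed.

Lemma unif_pseries_const (c : R) :
  unif_pseries (fun _ => c) 0 (fun j => if Nat.eqb j 0 then c else 0).
Proof.
  exists (fun _ => 0). split; [apply is_lim_seq_const|]. intros N z Hz.
  assert (E : sum_f_R0 (fun j => (if Nat.eqb j 0 then c else 0) * z ^ (0 + j)) N = c).
  { induction N as [|N IH]; [simpl; ring|]. rewrite tech5 IH. simpl. ring. }
  rewrite E Rminus_diag Rabs_R0. lra.
Qed.

(** Taylor coefficients of [(1 - z)^(n + 1/2)] at [0]. *)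
Definition half_binomial (n j : nat) : R := poch (- INR n - 1 / 2) j / INR (fact j).

Lemma unif_pseries_sqrt_pow (n : nat) :
  unif_pseries (fun z => sqrt (1 - z) ^ (2 * n + 1)) 0 (half_binomial n).
Proof.
  exists (fun N => Rabs (poch (1 / 2 - INR n) N / INR (fact N))). split.
  - apply (proj1 (is_lim_seq_abs_0 _)), is_lim_seq_poch_half_fact.
  - intros N z Hz. now apply binomial_remainder.
Qed.

Lemma poch_opp_INR (l i : nat) : (i <= l)%nat ->
  poch (- INR l) i = (-1) ^ i * (INR (fact l) / INR (fact (l - i))).
Proof.
  induction i as [|i IH]; intros Hi.
  - simpl. rewrite Nat.sub_0_r. field. apply INR_fact_neq_0.
  - simpl poch. rewrite IH; [|lia]. replace (l - i)%nat with (S (l - S i)) by lia.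
    rewrite fact_simpl mult_INR. replace (- INR l + INR i) with (- INR (S (l - S i))).
    + change ((-1) ^ S i) with (-1 * (-1) ^ i). field.
      split; [apply INR_fact_neq_0|apply not_0_INR; lia].
    + replace (S (l - S i)) with (l - i)%nat by lia. rewrite minus_INR; [ring|lia].
Qed.

Lemma one_minus_sqr_pow (l : nat) (x : R) :
  (1 - x ^ 2) ^ l = sum_f_R0 (fun n => poch (- INR l) n / INR (fact n) * x ^ (2 * n)) l.
Proof.
  replace (1 - x ^ 2) with (- x ^ 2 + 1) by ring. rewrite binomial.
  apply sum_eq. intros i Hi. rewrite pow1 Rmult_1_r poch_opp_INR; [|exact Hi].
  unfold Binomial.C. replace (- x ^ 2) with (-1 * x ^ 2) by ring.
  rewrite Rpow_mult_distr -pow_mult. field. split; apply INR_fact_neq_0.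
Qed.

(** Telescoping leaves [(1/2) / (n + 1/2)], the factor produced by integrating [x^(2n)] from [0]. *)
Lemma poch_half_quotient (n : nat) : poch (1 / 2) n / poch (3 / 2) n = / (2 * INR n + 1).
Proof.
  assert (E : poch (1 / 2) n * (2 * INR n + 1) = poch (3 / 2) n).
  { induction n as [|n IH]; [simpl; ring|].
    change (poch (1 / 2) (S n)) with (poch (1 / 2) n * (1 / 2 + INR n)).
    change (poch (3 / 2) (S n)) with (poch (3 / 2) n * (3 / 2 + INR n)).
    rewrite -IH S_INR. field. }
  assert (P := poch_pos (3 / 2) n ltac:(lra)). assert (Hn := pos_INR n).
  apply (Rmult_eq_reg_r (poch (3 / 2) n * (2 * INR n + 1))); [|nra].
  transitivity (poch (1 / 2) n * (2 * INR n + 1)); [field; lra|]. rewrite E. field. lra.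
Qed.

(** Coefficient of [x^(2n + 1)] in the antiderivative of [(1 - x^2)^l] that vanishes at [0]. *)
Definition lens_coeff (l n : nat) : R :=
  poch (- INR l) n * poch (1 / 2) n / poch (3 / 2) n / INR (fact n).

Lemma is_RInt_one_minus_sqr_pow (l : nat) (y : R) :
  is_RInt (fun x => (1 - x ^ 2) ^ l) y 1
    (sum_f_R0 (lens_coeff l) l - sum_f_R0 (fun n => lens_coeff l n * y ^ (2 * n + 1)) l).
Proof.
  assert (D : forall M x, is_derive (fun x => sum_f_R0 (fun n => lens_coeff l n * x ^ (2 * n + 1)) M) x
    (sum_f_R0 (fun n => poch (- INR l) n / INR (fact n) * x ^ (2 * n)) M)).
  { intros M x.
    assert (D1 : forall n, is_derive (fun x => lens_coeff l n * x ^ (2 * n + 1)) x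
      (poch (- INR l) n / INR (fact n) * x ^ (2 * n))).
    { intros n. evar_last.
      - apply is_derive_scal, (is_derive_pow (fun x => x) (2 * n + 1) x 1).
        apply: is_derive_id.
      - replace (pred (2 * n + 1)) with (2 * n)%nat by lia.
        unfold lens_coeff.
        replace (poch (- INR l) n * poch (1 / 2) n / poch (3 / 2) n)
          with (poch (- INR l) n * (poch (1 / 2) n / poch (3 / 2) n)) by (unfold Rdiv; ring).
        rewrite poch_half_quotient plus_INR mult_INR. simpl (INR 2). simpl (INR 1).
        assert (Hn := pos_INR n). field. split; [apply INR_fact_neq_0|lra]. }
    induction M as [|M IH]; [apply D1|].
    apply: (is_derive_plus (V := R_NormedModule)); [exact IH|apply D1]. }
  assert (I := is_RInt_derive (V := R_CompleteNormedModule) _ _ y 1 (fun x _ => D l x)).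
  replace (sum_f_R0 (lens_coeff l) l) with
    (sum_f_R0 (fun n => lens_coeff l n * 1 ^ (2 * n + 1)) l).
  2: { apply sum_eq. intros. now rewrite pow1 Rmult_1_r. }
  apply: is_RInt_ext; [|apply I].
  - intros x _. symmetry. apply one_minus_sqr_pow.
  - intros x _. apply (continuous_ext (fun x => (1 - x ^ 2) ^ l)).
    + intros t. apply one_minus_sqr_pow.
    + smooth.
Qed.

(* Chu-Vandermonde at these parameters: the sum is the integral of [(1 - x^2)^l] over
   [0, 1], whose recursion comes from differentiating [x (1 - x^2)^(l+1)]. *)
Lemma sum_lens_coeff (l : nat) : sum_f_R0 (lens_coeff l) l = poch 1 l / poch (3 / 2) l.
Proof.
  assert (I : forall l, is_RInt (fun x => (1 - x ^ 2) ^ l) 0 1 (sum_f_R0 (lens_coeff l) l)).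
  { intros k. assert (I := is_RInt_one_minus_sqr_pow k 0).
    replace (sum_f_R0 (fun n => lens_coeff k n * 0 ^ (2 * n + 1)) k) with 0 in I.
    - now rewrite Rminus_0_r in I.
    - symmetry. apply sum_eq_R0. intros n _. rewrite pow_i; [ring|lia]. }
  induction l as [|l IH]; [unfold lens_coeff; simpl; field|].
  assert (D : is_RInt (fun x => (2 * INR (S l) + 1) * (1 - x ^ 2) ^ S l
    - 2 * INR (S l) * (1 - x ^ 2) ^ l) 0 1 0).
  { assert (J := is_RInt_derive (V := R_CompleteNormedModule) (fun x => x * (1 - x ^ 2) ^ S l)
      (fun x => (2 * INR (S l) + 1) * (1 - x ^ 2) ^ S l - 2 * INR (S l) * (1 - x ^ 2) ^ l) 0 1).
    replace 0 with (minus (1 * (1 - 1 ^ 2) ^ S l) (0 * (1 - 0 ^ 2) ^ S l)) at 2.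
    - apply J.
      + intros x _. evar_last.
        * apply (is_derive_mult (fun x => x) (fun x => (1 - x ^ 2) ^ S l) x 1
            (INR (S l) * (- 2 * x) * (1 - x ^ 2) ^ pred (S l))).
          -- apply: is_derive_id.
          -- apply (is_derive_pow (fun x => 1 - x ^ 2) (S l) x (- 2 * x)). auto_derive; auto. ring.
          -- intros; apply Rmult_comm.
        * unfold plus, mult; simpl pred.
          change ((1 - x ^ 2) ^ S l) with ((1 - x ^ 2) * (1 - x ^ 2) ^ l).
          change (1 * ((1 - x ^ 2) * (1 - x ^ 2) ^ l) + x * (INR (S l) * (-2 * x) * (1 - x ^ 2) ^ l)
            = (2 * INR (S l) + 1) * ((1 - x ^ 2) * (1 - x ^ 2) ^ l)
              - 2 * INR (S l) * (1 - x ^ 2) ^ l).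
          ring.
      + intros x _. smooth.
    - unfold minus, plus, opp; simpl. ring. }
  assert (D2 := is_RInt_minus _ _ _ _ _ _ (is_RInt_scal _ _ _ (2 * INR (S l) + 1) _ (I (S l)))
    (is_RInt_scal _ _ _ (2 * INR (S l)) _ (I l))).
  assert (E := is_RInt_unique _ _ _ _ D). rewrite (is_RInt_unique _ _ _ _ D2) in E.
  change ((2 * INR (S l) + 1) * sum_f_R0 (lens_coeff (S l)) (S l)
    - 2 * INR (S l) * sum_f_R0 (lens_coeff l) l = 0) in E.
  rewrite IH in E. set X := sum_f_R0 (lens_coeff (S l)) (S l) in E |- *. clearbody X.
  change (poch 1 (S l)) with (poch 1 l * (1 + INR l)).
  change (poch (3 / 2) (S l)) with (poch (3 / 2) l * (3 / 2 + INR l)).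
  rewrite S_INR in E. assert (P := poch_pos (3 / 2) l ltac:(lra)). assert (Hl := pos_INR l).
  apply (Rmult_eq_reg_l (2 * (INR l + 1) + 1)); [|lra].
  transitivity (2 * (INR l + 1) * (poch 1 l / poch (3 / 2) l)); [lra|]. field. lra.
Qed.

(** Taylor coefficients of [lens l 0 (1 - z)] in [z]; the antiderivative at the upper limit [1]
    enters the constant term only. *)
Definition lens_series (l j : nat) : R :=
  (if Nat.eqb j 0 then poch 1 l / poch (3 / 2) l else 0)
  - sum_f_R0 (fun n => lens_coeff l n * half_binomial n j) l.

Lemma unif_pseries_lens_0 (l : nat) :
  unif_pseries (fun z => lens l 0 (1 - z)) 0 (lens_series l).
Proof.
  (* [lens_coeff l] depends on [l], so the induction runs over a separate upper limit [M] with the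
     coefficients held fixed. *)
  assert (H : forall M, unif_pseries (fun z => poch 1 l / poch (3 / 2) l -
      sum_f_R0 (fun n => lens_coeff l n * sqrt (1 - z) ^ (2 * n + 1)) M) 0
    (fun j => (if Nat.eqb j 0 then poch 1 l / poch (3 / 2) l else 0)
      - sum_f_R0 (fun n => lens_coeff l n * half_binomial n j) M)).
  { induction M as [|M IH].
    - apply: unif_pseries_ext; [..|apply (unif_pseries_lin _ _ 0 _ _ (- lens_coeff l 0)
        (unif_pseries_const (poch 1 l / poch (3 / 2) l)) (unif_pseries_sqrt_pow 0))].
      + intros z _. cbn -[poch lens_coeff Nat.mul Nat.add]. ring.
      + intros j. cbn -[poch lens_coeff half_binomial]. ring.
    - apply: unif_pseries_ext; [..|apply (unif_pseries_lin _ _ 0 _ _ (- lens_coeff l (S M))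
        IH (unif_pseries_sqrt_pow (S M)))].
      + intros z _. rewrite tech5. ring.
      + intros j. rewrite tech5. ring. }
  apply: unif_pseries_ext; [..|apply (H l)]; [|reflexivity].
  intros z Hz. unfold lens. rewrite Rmin_right.
  - rewrite -sum_lens_coeff. symmetry.
    apply: is_RInt_unique. apply: is_RInt_ext; [|apply is_RInt_one_minus_sqr_pow].
    intros x _. simpl. ring.
  - rewrite -{2}sqrt_1. apply sqrt_le_1_alt. lra.
Qed.

(** The error at level [m + 1] vanishes at [z = 0] and its derivative is [m + 1] times the error at
    level [m], so the mean value theorem carries the uniform bound over with a factor [m + 1]. The
    coefficients move by [(m + 1)_j (m + 1 + j) = (m + 1) (m + 2)_j]. *)
Lemma unif_pseries_lens (l m : nat) :
  unif_pseries (fun z => lens l m (1 - z)) m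
    (fun j => lens_series l j * poch 1 j / poch (INR m + 1) j).
Proof.
  induction m as [|m [e [He H]]].
  - apply: unif_pseries_ext (unif_pseries_lens_0 l); [reflexivity|].
    intros j. simpl INR. rewrite Rplus_0_l. field. apply Rgt_not_eq, poch_pos. lra.
  - exists (fun N => INR (S m) * e N). split.
    { replace 0 with (INR (S m) * 0) by ring. now apply (is_lim_seq_scal_l _ _ 0). }
    intros N z Hz.
    set P := fun y => lens l (S m) (1 - y) -
      sum_f_R0 (fun j => lens_series l j * poch 1 j / poch (INR (S m) + 1) j * y ^ (S m + j)) N.
    set dP := fun y => INR (S m) * (lens l m (1 - y) -
      sum_f_R0 (fun j => lens_series l j * poch 1 j / poch (INR m + 1) j * y ^ (m + j)) N).
    assert (dPoly : forall y, is_derive (fun y => sum_f_R0 (fun j =>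
        lens_series l j * poch 1 j / poch (INR (S m) + 1) j * y ^ (S m + j)) N) y
      (INR (S m) *
       sum_f_R0 (fun j => lens_series l j * poch 1 j / poch (INR m + 1) j * y ^ (m + j)) N)).
    { intros y.
      assert (D1 : forall j, is_derive (fun y =>
          lens_series l j * poch 1 j / poch (INR (S m) + 1) j * y ^ (S m + j)) y
        (INR (S m) * (lens_series l j * poch 1 j / poch (INR m + 1) j * y ^ (m + j)))).
      { intros j. evar_last.
        - apply is_derive_scal, (is_derive_pow (fun x => x) (S m + j) y 1). apply: is_derive_id.
        - replace (pred (S m + j)) with (m + j)%nat by lia.
          assert (Hm := pos_INR m). assert (Hj := pos_INR j).
          assert (P1 := poch_pos (INR m + 1) j ltac:(lra)).
          assert (P2 := poch_pos (INR (S m) + 1) j ltac:(rewrite S_INR; lra)).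
          assert (E : poch (INR m + 1) j * (INR m + 1 + INR j)
            = (INR m + 1) * poch (INR (S m) + 1) j).
          { rewrite S_INR -poch_shift. reflexivity. }
          rewrite plus_INR. rewrite S_INR in E P2 |- *.
          set p1 := poch (INR m + 1) j in E P1 |- *.
          set p2 := poch (INR m + 1 + 1) j in E P2 |- *.
          apply (Rmult_eq_reg_r (p1 * p2)); [|nra].
          transitivity (lens_series l j * poch 1 j * y ^ (m + j) * (p1 * (INR m + 1 + INR j)));
            [field; lra|]. rewrite E. field. lra. }
      clear - D1. induction N as [|N IH]; [apply D1|].
      rewrite tech5 Rmult_plus_distr_l.
      apply: (is_derive_plus (V := R_NormedModule)); [exact IH|apply D1]. }
    assert (D : forall y, is_derive P y (dP y)).
    { intros y. unfold P, dP. rewrite Rmult_minus_distr_l.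
      apply: (is_derive_minus (V := R_NormedModule)); [|apply dPoly].
      evar_last.
      - apply (is_derive_comp (lens l (S m)) (fun y => 1 - y) y
            (- INR (S m) * lens l m (1 - y)) (-1)).
        + apply lens_derive.
        + auto_derive; auto.
      - change (-1 * (- INR (S m) * lens l m (1 - y)) = INR (S m) * lens l m (1 - y)). ring. }
    destruct (MVT_gen P 0 z dP) as [y [Hy E]].
    + intros y _. apply D.
    + intros y _. apply continuity_pt_filterlim. apply: ex_derive_continuous. eexists. apply D.
    + rewrite Rmin_left in Hy; [|lra]. rewrite Rmax_right in Hy; [|lra].
      assert (P0 : P 0 = 0).
      { unfold P. rewrite lens_ge_1; [|lra]. rewrite sum_eq_R0; [ring|].
        intros j _. rewrite pow_i; [ring|lia]. }
      rewrite P0 !Rminus_0_r in E. fold (P z). rewrite E. unfold dP.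
      rewrite !Rabs_mult (Rabs_pos_eq (INR (S m))); [|apply pos_INR]. rewrite (Rabs_pos_eq z); [|lra].
      specialize (H N y ltac:(lra)). set X := Rabs _ in H |- *.
      assert (0 <= X) by apply Rabs_pos. assert (Hm := pos_INR (S m)).
      apply Rle_trans with (INR (S m) * X); [|now apply Rmult_le_compat_l].
      assert (0 <= INR (S m) * X) by now apply Rmult_le_pos. nra.
Qed.

(* The terms [u j] satisfy [(c - 1 + j) u j - (c + j) u (j + 1) = (c - 1 - a) u j], so
   their sum telescopes once they have constant sign. *)
Lemma ex_series_poch_quotient (a c : R) : 1 <= c -> a < 0 ->
  ex_series (fun j => Rabs (poch a j / poch c j)).
Proof.
  intros Hc Ha. set u := fun j => Rabs (poch a j / poch c j).
  destruct (INR_unbounded (- a)) as [J HJ].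
  apply (ex_series_incr_n u J).
  set y := fun j => (c - 1 + INR (J + j)) * u (J + j)%nat.
  assert (Hpc : forall j, 0 < poch c j) by (intros; apply poch_pos; lra).
  assert (Hy : forall j, y j - y (S j) = (c - 1 - a) * u (J + j)%nat).
  { intros j. unfold y, u. replace (J + S j)%nat with (S (J + j)) by lia.
    simpl poch. rewrite S_INR. set i := (J + j)%nat.
    assert (Hi : - a < INR i).
    { apply Rlt_le_trans with (1 := HJ). apply le_INR. lia. }
    replace (poch a i * (a + INR i) / (poch c i * (c + INR i)))
      with (poch a i / poch c i * ((a + INR i) / (c + INR i))).
    2: { specialize (Hpc i). field. lra. }
    rewrite Rabs_mult (Rabs_pos_eq ((a + INR i) / (c + INR i))).
    - field. lra.
    - apply Rdiv_le_0_compat; lra. }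
  assert (Hu : forall j, 0 <= u j) by (intros; apply Rabs_pos).
  assert (Hlim : ex_finite_lim_seq y).
  { apply ex_finite_lim_seq_decr with 0.
    - intros j. specialize (Hy j). specialize (Hu (J + j)%nat). nra.
    - intros j. apply Rmult_le_pos; [|apply Hu]. assert (H := pos_INR (J + j)). lra. }
  destruct Hlim as [L HL].
  exists ((y 0%nat - L) / (c - 1 - a)).
  change (is_lim_seq (sum_n (fun k => u (J + k)%nat)) ((y 0%nat - L) / (c - 1 - a))).
  apply (is_lim_seq_ext (fun N => (y 0%nat - y (S N)) / (c - 1 - a))).
  - intros N. induction N as [|N IH].
    + rewrite sum_O Hy. field. lra.
    + rewrite sum_Sn -IH. unfold plus; simpl.
      replace (u (J + S N)%nat) with ((y (S N) - y (S (S N))) / (c - 1 - a)).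
      * field. lra.
      * rewrite Hy. field. lra.
  - apply (is_lim_seq_mult' (fun N => y 0%nat - y (S N)) (fun _ => / (c - 1 - a)));
      [|apply is_lim_seq_const].
    apply is_lim_seq_minus'; [apply is_lim_seq_const|]. now apply (is_lim_seq_incr_1 y).
Qed.

(** The factor [poch 1 j] cancels the factorial, and the terms are dominated by those at [z = 1],
    where [c - a - 1 > 0] is Gauss's condition for convergence. *)
Lemma ex_series_hyp2F1 (a c z : R) : 1 <= c -> a < 0 -> 0 <= z <= 1 ->
  ex_series (fun j => poch a j * poch 1 j / poch c j * z ^ j / INR (fact j)).
Proof.
  intros Hc Ha Hz. apply: (ex_series_le (V := R_CompleteNormedModule)); [|apply (ex_series_poch_quotient a c Hc Ha)].
  intros j. rewrite poch_1_fact.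
  replace (poch a j * INR (fact j) / poch c j * z ^ j / INR (fact j))
    with (poch a j / poch c j * z ^ j).
  2: { field. split; [|apply INR_fact_neq_0]. apply Rgt_not_eq, poch_pos. lra. }
  change (Rabs (poch a j / poch c j * z ^ j) <= Rabs (poch a j / poch c j)).
  rewrite Rabs_mult -[X in _ <= X]Rmult_1_r. apply Rmult_le_compat_l; [apply Rabs_pos|].
  rewrite Rabs_pos_eq; [|apply pow_le; lra]. rewrite -[X in _ <= X](pow1 j). apply pow_incr. lra.
Qed.

(** * Termwise fractional integration *)

(* An antiderivative of [(x - s)^(nu - 1) (2 - x)^M], from repeated integration by parts. *)
Fixpoint beta_primitive (s : R) (M : nat) (nu x : R) : R :=
  match M with
  | O => / nu * Rpower (x - s) nu
  | S M' => / nu * (Rpower (x - s) nu * (2 - x) ^ M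
                    + INR M * beta_primitive s M' (nu + 1) x)
  end.

Lemma Rpower_shift_derive (s nu x : R) : s < x ->
  is_derive (fun x => Rpower (x - s) nu) x (nu * Rpower (x - s) (nu - 1)).
Proof.
  intros Hx. evar_last.
  - apply (is_derive_comp (fun y => Rpower y nu) (fun x => x - s) x
      (nu * Rpower (x - s) (nu - 1)) 1).
    + apply Rpower_derive. lra.
    + auto_derive; auto.
  - change (1 * (nu * Rpower (x - s) (nu - 1)) = nu * Rpower (x - s) (nu - 1)). ring.
Qed.

Lemma beta_primitive_derive (s nu x : R) (M : nat) : 0 < nu -> s < x ->
  is_derive (beta_primitive s M nu) x (Rpower (x - s) (nu - 1) * (2 - x) ^ M).
Proof.
  intros Hnu Hx. revert nu Hnu. induction M as [|M IH]; intros nu Hnu.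
  - simpl. evar_last; [apply is_derive_scal, Rpower_shift_derive, Hx|]. field. lra.
  - evar_last.
    + apply is_derive_scal.
      apply (is_derive_plus (V := R_NormedModule)
        (fun x => Rpower (x - s) nu * (2 - x) ^ S M)
        (fun x => INR (S M) * beta_primitive s M (nu + 1) x)).
      * apply (is_derive_mult (fun x => Rpower (x - s) nu) (fun x => (2 - x) ^ S M) x
          (nu * Rpower (x - s) (nu - 1)) (INR (S M) * -1 * (2 - x) ^ M)).
        -- apply Rpower_shift_derive, Hx.
        -- apply (is_derive_pow (fun x => 2 - x) (S M) x (-1)). auto_derive; auto.
        -- intros; apply Rmult_comm.
      * apply is_derive_scal, IH. lra.
    + replace (nu + 1 - 1) with nu by ring. set k := INR (S M).
      change (/ nu * ((nu * Rpower (x - s) (nu - 1) * (2 - x) ^ S M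
        + Rpower (x - s) nu * (k * -1 * (2 - x) ^ M)) + k * (Rpower (x - s) nu * (2 - x) ^ M))
        = Rpower (x - s) (nu - 1) * (2 - x) ^ S M).
      field. lra.
Qed.

(** The factors [2 - x] kill every boundary term but the last. With the limit [0] at [s] this is the
    Beta integral [B(nu, M + 1) (2 - s)^(nu + M)]. *)
Lemma beta_primitive_2 (s nu : R) (M : nat) : 0 < nu ->
  beta_primitive s M nu 2 = INR (fact M) * Rpower (2 - s) (nu + INR M) / poch nu (S M).
Proof.
  revert nu. induction M as [|M IH]; intros nu Hnu.
  - simpl. rewrite !Rplus_0_r. field. lra.
  - simpl beta_primitive. fold (INR (S M)). rewrite IH; [|lra]. rewrite (poch_shift nu (S M)).
    rewrite Rminus_diag Rmult_0_l Rmult_0_r Rplus_0_l fact_simpl mult_INR.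
    replace (nu + 1 + INR M) with (nu + INR (S M)) by (rewrite S_INR; ring).
    assert (P := poch_pos (nu + 1) (S M) ltac:(lra)).
    change (match M with O => 1 | S _ => INR M + 1 end) with (INR (S M)).
    field. lra.
Qed.

(** A limit and not a value: [Rpower 0 nu] is [1], so evaluation at [x = s] would give a wrong
    boundary term. *)
Lemma beta_primitive_lim (s nu : R) (M : nat) : 0 < nu ->
  filterlim (beta_primitive s M nu) (at_right s) (locally 0).
Proof.
  assert (L : forall nu, 0 < nu -> filterlim (fun x => Rpower (x - s) nu) (at_right s) (locally 0)).
  { intros mu Hmu. apply (filterlim_comp _ _ _ (fun x => x - s) (fun t => Rpower t mu) _ (at_right 0));
      [|now apply Rpower_lim_0].
    intros P [eps HP]. exists eps. intros x Hx Hlt. apply HP; [|lra].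
    apply ball_of_Rabs. apply Rabs_of_ball in Hx. now rewrite Rminus_0_r. }
  revert nu. induction M as [|M IH]; intros nu Hnu.
  - simpl. replace 0 with (/ nu * 0) at 1 by ring.
    apply: filterlim_comp; [apply (L nu Hnu)|].
    apply (filterlim_scal_r (K := R_AbsRing) (V := R_NormedModule) (/ nu) 0).
  - replace 0 with (/ nu * (0 * (2 - s) ^ S M + INR (S M) * 0)) at 1 by ring.
    apply: (filterlim_comp _ _ _ (fun x => Rpower (x - s) nu * (2 - x) ^ S M
                    + INR (S M) * beta_primitive s M (nu + 1) x) (fun y => / nu * y));
      [|apply (filterlim_scal_r (K := R_AbsRing) (V := R_NormedModule) (/ nu))].
    apply: (filterlim_comp_2 (G := locally (0 * (2 - s) ^ S M)) (H := locally (INR (S M) * 0)));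
      [| |apply (filterlim_plus (V := R_NormedModule))].
    + apply: (filterlim_comp_2 (G := locally 0) (H := locally ((2 - s) ^ S M)));
      [now apply L| |apply (filterlim_mult (K := R_AbsRing))].
      assert (C : continuous (fun x => (2 - x) ^ S M) s) by smooth.
      apply: filterlim_filter_le_1 C. apply filter_le_within.
    + apply: filterlim_comp; [apply IH; lra|].
      apply (filterlim_scal_r (K := R_AbsRing) (V := R_NormedModule) (INR (S M)) 0).
Qed.

Section Fractional.
Variables (s nu : R) (m : nat) (g : R -> R) (b e : nat -> R).
Hypotheses (Hs : s < 2) (Hs0 : 0 <= s) (Hnu : 0 < nu).
Hypothesis g_continuous : forall x, continuous g x.
Hypothesis g_support : forall x, 2 <= x -> g x = 0.
Hypothesis He : is_lim_seq e 0.
Hypothesis g_approx : forall N x, 0 <= x <= 2 ->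
  Rabs (g x - sum_f_R0 (fun j => b j * (2 - x) ^ (m + j)) N) <= e N.

Let U (N : nat) (x : R) := sum_f_R0 (fun j => b j * beta_primitive s (m + j) nu x) N.
Let T := / nu * Rpower (2 - s) nu.
Let I (a : R) := RInt (fun x => Rpower (x - s) (nu - 1) * g x) a 2.

Lemma kernel_continuous (x : R) : s < x -> continuous (fun x => Rpower (x - s) (nu - 1)) x.
Proof. intros H. unfold Rpower. apply: ex_derive_continuous. auto_derive. lra. Qed.

Lemma partial_primitive_derive (N : nat) (x : R) : s < x -> is_derive (U N) x
  (Rpower (x - s) (nu - 1) * sum_f_R0 (fun j => b j * (2 - x) ^ (m + j)) N).
Proof.
  intros Hx.
  assert (D : forall j, is_derive (fun x => b j * beta_primitive s (m + j) nu x) x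
    (Rpower (x - s) (nu - 1) * (b j * (2 - x) ^ (m + j)))).
  { intros j. evar_last; [apply is_derive_scal, beta_primitive_derive; [exact Hnu|exact Hx]|]. ring. }
  unfold U. induction N as [|N IH]; [apply D|].
  rewrite tech5 Rmult_plus_distr_l.
  apply: (is_derive_plus (V := R_NormedModule)); [exact IH|apply D].
Qed.

Lemma kernel_g_integrable (a c : R) : s < a <= c ->
  ex_RInt (fun x => Rpower (x - s) (nu - 1) * g x) a c.
Proof.
  intros Ha. apply: ex_RInt_continuous => x. rewrite Rmin_left; [|lra]. intros Hx.
  apply: (continuous_mult (K := R_AbsRing)); [apply kernel_continuous; lra|apply g_continuous].
Qed.

(** The kernel is positive and its mass on [[a, 2]] is below [T] for every [a], so a uniform error
    [e N] costs at most [e N * T]. As this does not depend on [a], the index [N] can be fixed before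
    [a] tends to [s]. *)
Lemma partial_primitive_approx (N : nat) (a : R) : s < a <= 2 -> Rabs (I a - (U N 2 - U N a)) <= e N * T.
Proof.
  intros Ha.
  assert (Hm : Rmin a 2 = a) by (apply Rmin_left; lra).
  assert (HM : Rmax a 2 = 2) by (apply Rmax_right; lra).
  assert (IU : is_RInt (fun x => Rpower (x - s) (nu - 1) *
      sum_f_R0 (fun j => b j * (2 - x) ^ (m + j)) N) a 2 (minus (U N 2) (U N a))).
  { apply: (is_RInt_derive (V := R_CompleteNormedModule)); rewrite Hm HM; intros x Hx.
    - apply partial_primitive_derive. lra.
    - apply: (continuous_mult (K := R_AbsRing)); [apply kernel_continuous; lra|].
      clear. induction N as [|N IH]; [simpl; smooth|].
      apply: (continuous_plus (V := R_NormedModule)); [exact IH|smooth]. }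
  assert (IK : is_RInt (fun x => Rpower (x - s) (nu - 1)) a 2
    (minus (/ nu * Rpower (2 - s) nu) (/ nu * Rpower (a - s) nu))).
  { apply: (is_RInt_derive (V := R_CompleteNormedModule) (fun x => / nu * Rpower (x - s) nu));
      rewrite Hm HM; intros x Hx.
    - evar_last; [apply is_derive_scal, Rpower_shift_derive; lra|]. field. lra.
    - apply kernel_continuous. lra. }
  assert (IG := RInt_correct _ _ _ (kernel_g_integrable a 2 Ha)).
  assert (ID := is_RInt_minus _ _ _ _ _ _ IG IU).
  assert (IKe := is_RInt_scal _ _ _ (e N) _ IK).
  apply Rle_trans with (e N * (/ nu * Rpower (2 - s) nu - / nu * Rpower (a - s) nu)).
  - apply (norm_RInt_le (V := R_NormedModule) _ _ a 2 _ _ (proj2 Ha)) with (2 := ID) (3 := IKe).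
    intros x Hx.
    change (Rabs (Rpower (x - s) (nu - 1) * g x - Rpower (x - s) (nu - 1) *
      sum_f_R0 (fun j => b j * (2 - x) ^ (m + j)) N) <= e N * Rpower (x - s) (nu - 1)).
    rewrite -Rmult_minus_distr_l Rabs_mult (Rabs_pos_eq (Rpower _ _)); [|left; apply exp_pos].
    rewrite Rmult_comm. apply Rmult_le_compat_r; [left; apply exp_pos|]. apply g_approx. lra.
  - assert (0 <= e N) by (apply: Rle_trans; [apply Rabs_pos|apply (g_approx N 0); lra]).
    apply Rmult_le_compat_l; [assumption|]. unfold T.
    assert (0 < / nu * Rpower (a - s) nu)
      by (apply Rmult_lt_0_compat; [now apply Rinv_0_lt_compat|apply exp_pos]).
    lra.
Qed.

Lemma partial_primitive_lim (N : nat) : filterlim (U N) (at_right s) (locally 0).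
Proof.
  unfold U. induction N as [|N IH].
  - replace 0 with (b 0%nat * 0) at 1 by ring.
    apply: filterlim_comp; [apply (beta_primitive_lim s nu (m + 0) Hnu)|].
    apply (filterlim_scal_r (K := R_AbsRing) (V := R_NormedModule) (b 0%nat) 0).
  - replace 0 with (0 + b (S N) * 0) at 1 by ring.
    apply: (filterlim_comp_2 (G := locally 0) (H := locally (b (S N) * 0)));
      [exact IH| |apply (filterlim_plus (V := R_NormedModule))].
    apply: filterlim_comp; [apply (beta_primitive_lim s nu (m + S N) Hnu)|].
    apply (filterlim_scal_r (K := R_AbsRing) (V := R_NormedModule) (b (S N)) 0).
Qed.

Lemma partial_primitive_near (N : nat) (eps : R) : 0 < eps ->
  at_right s (fun a => s < a <= 2 /\ Rabs (U N a) < eps).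
Proof.
  intros Heps. apply filter_and.
  - exists (mkposreal (2 - s) ltac:(lra)). intros x Hx Hlt.
    apply Rabs_of_ball, Rabs_def2 in Hx. simpl in Hx. lra.
  - assert (H := proj1 (filterlim_locally _ _) (partial_primitive_lim N) (mkposreal _ Heps)).
    apply: filter_imp H. intros a Ha. apply Rabs_of_ball in Ha. now rewrite Rminus_0_r in Ha.
Qed.

Lemma scaled_error_small (eps : R) : 0 < eps -> exists N0, forall N, (N0 <= N)%nat -> e N * T < eps.
Proof.
  intros Heps.
  assert (H : is_lim_seq (fun N => e N * T) (0 * T))
    by (apply is_lim_seq_mult'; [exact He|apply is_lim_seq_const]).
  rewrite Rmult_0_l in H. apply is_lim_seq_spec in H.
  destruct (H (mkposreal _ Heps)) as [N0 HN]. exists N0. intros N HN0.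
  specialize (HN N HN0). rewrite Rminus_0_r in HN. simpl in HN. apply Rabs_def2 in HN. lra.
Qed.

Lemma is_RInt_gen_fractional (L : R) : is_lim_seq (fun N => U N 2) L ->
  is_RInt_gen (fun x => Rpower (x - s) (nu - 1) * g x) (at_right s) (Rbar_locally p_infty) L.
Proof.
  intros HL P [eps HP].
  assert (He3 : 0 < eps / 3) by (assert (H := cond_pos eps); lra).
  destruct (scaled_error_small _ He3) as [N0 HN0].
  apply is_lim_seq_spec in HL. destruct (HL (mkposreal _ He3)) as [N1 HN1].
  (* [N] is fixed first, to make [e N * T] small and [U N 2] close to [L]; only then is [a] taken so
     near [s] that [U N a] is small. Each error gets a third of [eps]. *)
  set N := max N0 N1.
  specialize (HN0 N ltac:(lia)). specialize (HN1 N ltac:(lia)). simpl in HN1.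
  exists (fun a => s < a <= 2 /\ Rabs (U N a) < eps / 3) (fun c => 2 < c).
  - now apply partial_primitive_near.
  - now exists 2.
  - intros a c [Ha HU] Hc. exists (I a). split.
    + simpl. rewrite -(Rplus_0_r (I a)).
      apply: (is_RInt_Chasles (V := R_NormedModule) _ a 2 c).
      * apply: RInt_correct. now apply kernel_g_integrable.
      * apply is_RInt_zero. intros x Hx. rewrite Rmin_left in Hx; [|lra].
        rewrite g_support; [ring|lra].
    + apply HP, ball_of_Rabs. assert (A1 := partial_primitive_approx N a Ha).
      apply Rabs_le_between in A1. apply Rabs_def2 in HN1. apply Rabs_def2 in HU.
      apply Rabs_def1; lra.
Qed.

End Fractional.

(** * The generalized Wu function *)

Lemma poch_add (a : R) (i j : nat) : poch a (i + j) = poch a i * poch (a + INR i) j.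
Proof.
  induction j as [|j IH]; [rewrite Nat.add_0_r; simpl; ring|].
  replace (i + S j)%nat with (S (i + j)) by lia. simpl poch. rewrite IH plus_INR. ring.
Qed.

(** The third parameter of [hyp2F1] stays free because it is [m + 1] before the fractional
    integration and [nu + m + 1] after it. *)
Definition wu_bracket (l : nat) (c z : R) : R :=
  poch 1 l / poch (3 / 2) l
  - sum_f_R0 (fun n => lens_coeff l n * hyp2F1 (- INR n - 1 / 2) 1 c z) l.

(** The sum over [n] is finite, so exchanging it with the series in [j] is linearity of limits. *)
Lemma wu_bracket_series (l : nat) (c z : R) : 1 <= c -> 0 <= z <= 1 ->
  is_lim_seq (fun N => sum_f_R0 (fun j => lens_series l j * poch 1 j / poch c j * z ^ j) N)
    (wu_bracket l c z).
Proof.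
  intros Hc Hz.
  set C0 := poch 1 l / poch (3 / 2) l.
  set q := fun j => poch 1 j / poch c j * z ^ j.
  assert (Hq : forall n, is_lim_seq (fun N => sum_f_R0 (fun j => half_binomial n j * q j) N)
    (hyp2F1 (- INR n - 1 / 2) 1 c z)).
  { intros n.
    assert (Ha : - INR n - 1 / 2 < 0) by (assert (H := pos_INR n); lra).
    apply (is_lim_seq_ext (sum_n (fun j => poch (- INR n - 1 / 2) j * poch 1 j / poch c j
      * z ^ j / INR (fact j))));
      [|exact (Series_correct _ (ex_series_hyp2F1 (- INR n - 1 / 2) c z Hc Ha Hz))].
    intros N. rewrite sum_n_Reals. apply sum_eq. intros j _.
    unfold half_binomial, q, Rdiv. ring. }
  assert (H : forall M, is_lim_seq (fun N => sum_f_R0 (fun j =>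
      ((if Nat.eqb j 0 then C0 else 0) - sum_f_R0 (fun n => lens_coeff l n * half_binomial n j) M)
      * q j) N)
    (C0 - sum_f_R0 (fun n => lens_coeff l n * hyp2F1 (- INR n - 1 / 2) 1 c z) M)).
  { induction M as [|M IH].
    - apply (is_lim_seq_ext (fun N => C0 - lens_coeff l 0 *
        sum_f_R0 (fun j => half_binomial 0 j * q j) N)).
      + intros N. rewrite scal_sum. induction N as [|N IH].
        * unfold q. cbn -[lens_coeff half_binomial]. field.
        * rewrite tech5 (tech5 _ N) -IH. cbn -[lens_coeff half_binomial sum_f_R0]. simpl (sum_f_R0 _ 0). ring.
      + apply: is_lim_seq_minus'; [apply is_lim_seq_const|].
        apply (is_lim_seq_scal_l _ (lens_coeff l 0) (Finite _)), Hq.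
    - rewrite tech5.
      apply (is_lim_seq_ext (fun N => sum_f_R0 (fun j =>
        ((if Nat.eqb j 0 then C0 else 0) - sum_f_R0 (fun n => lens_coeff l n * half_binomial n j) M)
        * q j) N - lens_coeff l (S M) * sum_f_R0 (fun j => half_binomial (S M) j * q j) N)).
      + intros N. rewrite scal_sum -minus_sum. apply sum_eq. intros j _. rewrite tech5. ring.
      + rewrite /Rminus Ropp_plus_distr -Rplus_assoc.
        apply: is_lim_seq_minus'; [exact IH|].
        apply (is_lim_seq_scal_l _ (lens_coeff l (S M)) (Finite _)), Hq. }
  apply: is_lim_seq_ext (H l). intros N. apply sum_eq. intros j _.
  unfold lens_series, q, C0, Rdiv. ring.
Qed.

(** The same partial sums converge to both sides. This settles integer [k], where no fractional
    integration takes place. *)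
Lemma lens_wu_bracket (l m : nat) (z : R) : 0 <= z <= 1 ->
  lens l m (1 - z) = z ^ m * wu_bracket l (INR m + 1) z.
Proof.
  intros Hz. destruct (unif_pseries_lens l m) as [e [He H]].
  assert (Hm := pos_INR m).
  assert (L1 := wu_bracket_series l (INR m + 1) z ltac:(lra) Hz).
  assert (L2 : is_lim_seq (fun N => sum_f_R0 (fun j =>
    lens_series l j * poch 1 j / poch (INR m + 1) j * z ^ (m + j)) N) (lens l m (1 - z))).
  { apply (is_lim_seq_le_le (fun N => lens l m (1 - z) - e N) _ (fun N => lens l m (1 - z) + e N)).
    - intros N. specialize (H N z Hz). apply Rabs_le_between in H. lra.
    - evar_last; [apply is_lim_seq_minus'; [apply is_lim_seq_const|exact He]|]. f_equal; ring.
    - evar_last; [apply is_lim_seq_plus'; [apply is_lim_seq_const|exact He]|]. f_equal; ring. }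
  assert (L3 : is_lim_seq (fun N => sum_f_R0 (fun j =>
    lens_series l j * poch 1 j / poch (INR m + 1) j * z ^ (m + j)) N)
    (z ^ m * wu_bracket l (INR m + 1) z)).
  { apply (is_lim_seq_scal_l _ (z ^ m)) in L1. apply: is_lim_seq_ext L1.
    intros N. rewrite scal_sum. apply sum_eq. intros j _. rewrite pow_add. ring. }
  apply is_lim_seq_unique in L2. apply is_lim_seq_unique in L3. congruence.
Qed.

(** In the Beta factor [(m + j)! / (nu)_(m + 1 + j)] the numerator is [m! (m + 1)_j], which cancels
    the denominator of the old coefficients; the denominator is [(nu)_(m + 1) (nu + m + 1)_j], which
    brings in the new third parameter. *)
Lemma is_RInt_gen_lens (l m : nat) (s nu z : R) : 0 < nu -> 0 <= s < 2 -> z = 1 - s / 2 ->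
  is_RInt_gen (fun x => Rpower (x - s) (nu - 1) * lens l m (x / 2))
    (at_right s) (Rbar_locally p_infty)
    (z ^ m * Rpower (2 * z) nu * INR (fact m) / poch nu (S m)
      * wu_bracket l (nu + INR (S m)) z).
Proof.
  intros Hnu Hs Hz. destruct (unif_pseries_lens l m) as [e [He H]].
  assert (Hm := pos_INR m).
  (* The division by [2^(m + j)] turns powers of [1 - x / 2] into powers of [2 - x], the form that
     [beta_primitive] integrates. *)
  set b := fun j => lens_series l j * poch 1 j / poch (INR m + 1) j / 2 ^ (m + j).
  apply (is_RInt_gen_fractional s nu m (fun x => lens l m (x / 2)) b e);
    [lra|lra|lra| | |exact He| |].
  - intros x. apply (continuous_comp (fun x => x / 2) (lens l m)); [smooth|apply lens_continuous].
  - intros x Hx. apply lens_ge_1. lra.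
  - intros N x Hx. specialize (H N (1 - x / 2) ltac:(lra)).
    replace (1 - (1 - x / 2)) with (x / 2) in H by ring.
    rewrite (sum_eq _ (fun j => lens_series l j * poch 1 j / poch (INR m + 1) j * (1 - x / 2) ^ (m + j)));
      [exact H|].
    intros j _. unfold b. replace (2 - x) with (2 * (1 - x / 2)) by field.
    rewrite Rpow_mult_distr. field. split; [|apply pow_nonzero; lra].
    apply Rgt_not_eq, poch_pos. lra.
  - assert (L := wu_bracket_series l (nu + INR (S m)) z ltac:(rewrite S_INR; lra) ltac:(lra)).
    apply (is_lim_seq_scal_l _ (z ^ m * Rpower (2 * z) nu * INR (fact m) / poch nu (S m))) in L.
    apply: is_lim_seq_ext L. intros N. rewrite scal_sum. apply sum_eq. intros j _.
    rewrite beta_primitive_2; [|exact Hnu]. unfold b.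
    replace (2 - s) with (2 * z) by lra.
    rewrite Rpower_plus Rpower_pow; [|lra].
    rewrite Rpow_mult_distr -!poch_1_fact (pow_add z).
    replace (S (m + j)) with (S m + j)%nat by lia.
    rewrite (poch_add nu) (poch_add 1 m). rewrite (Rplus_comm 1).
    field.
    repeat split; try (apply Rgt_not_eq, poch_pos; rewrite ?S_INR; lra).
    apply pow_nonzero. lra.
Qed.

Lemma nat_ceil_bounds (k : R) : 0 <= k -> k <= INR (nat_ceil k) < k + 1.
Proof.
  intros Hk. unfold nat_ceil. destruct (base_Int_part (- k)) as [H1 H2].
  assert (Hz : (0 <= - Int_part (- k))%Z).
  { apply le_IZR. rewrite opp_IZR. lra. }
  rewrite INR_IZR_INZ Z2Nat.id; [|exact Hz]. rewrite opp_IZR. lra.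
Qed.

(** Both powers take [0^0] to be [1], a case met at [k = l], [r = 2]. *)
Lemma rpow_INR (z : R) (m : nat) : 0 <= z -> rpow z (INR m) = z ^ m.
Proof.
  intros Hz. unfold rpow. destruct (Req_EM_T z 0) as [->|Hn].
  - destruct m as [|m].
    + simpl. destruct (Req_EM_T 0 0); [reflexivity|lra].
    + rewrite pow_i; [|lia]. destruct (Req_EM_T (INR (S m)) 0) as [E|]; [|reflexivity].
      exfalso. apply (not_0_INR (S m)); [lia|exact E].
  - apply Rpower_pow. lra.
Qed.

Theorem theorem4p4 (l : nat) (k : R) (hk0 : 0 <= k) (hkl : k <= INR l)
  (r : R) (hr0 : 0 <= r) (hr2 : r <= 2) :
  wu l k r =
  Rpower 2 (2 * INR l - k + 1) * Gamma (INR l + 1) / Gamma (INR l - k + 1)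
  * rpow (1 - r ^ 2 / 4) (INR l - k)
  * (poch 1 l / poch (3 / 2) l
     - sum_f_R0 (fun n => poch (- INR l) n * poch (1 / 2) n / poch (3 / 2) n
                          / INR (Factorial.fact n)
                          * hyp2F1 (- INR n - 1 / 2) 1 (INR l - k + 1) (1 - r ^ 2 / 4))
         l).
Proof.
  change (wu l k r = Rpower 2 (2 * INR l - k + 1) * Gamma (INR l + 1) / Gamma (INR l - k + 1)
    * rpow (1 - r ^ 2 / 4) (INR l - k) * wu_bracket l (INR l - k + 1) (1 - r ^ 2 / 4)).
  assert (Hn := nat_ceil_bounds k hk0). unfold wu, Finv, Ineg.
  set n := nat_ceil k in Hn |- *.
  assert (Hnl : (n <= l)%nat).
  { assert (INR n < INR (S l)) by (rewrite S_INR; lra). apply INR_lt in H. lia. }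
  set m := (l - n)%nat. set s := r ^ 2 / 2. set z := 1 - r ^ 2 / 4.
  set nu := INR n - k.
  assert (Hl : INR l = INR m + INR n) by (unfold m; rewrite minus_INR; [ring|exact Hnl]).
  assert (Hs : 0 <= s <= 2) by (unfold s; nra).
  assert (Hz : z = 1 - s / 2) by (unfold z, s; field).
  assert (Hz1 : 0 <= z <= 1) by lra.
  assert (H1z : s / 2 = 1 - z) by lra.
  set K := 2 ^ (2 * l + 1) / 2 ^ n * (INR (fact l) / INR (fact m)).
  assert (Hphi : forall x, 0 <= x -> Ineg_nat n (Fform (conv_ff l)) x = K * lens l m (x / 2)).
  { intros x Hx. now apply Ineg_nat_wu. }
  assert (GN : forall i, Gamma (INR i + 1) = INR (fact i)).
  { intros i. apply is_Gamma_unique. rewrite Rplus_comm -poch_1_fact -(Rmult_1_l (poch 1 i)).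
    apply is_Gamma_poch; [lra|apply is_Gamma_1]. }
  assert (P2 : Rpower 2 (2 * INR l - k + 1) = 2 ^ (2 * l + 1) / 2 ^ n * Rpower 2 nu).
  { replace (2 * INR l - k + 1) with (INR (2 * l + 1) + (- INR n + nu)).
    - rewrite !Rpower_plus Rpower_Ropp !Rpower_pow; [field; apply pow_nonzero; lra|lra|lra].
    - unfold nu. rewrite plus_INR mult_INR. simpl. ring. }
  replace (INR l - k) with (INR m + nu) by (unfold nu; lra).
  rewrite GN P2. unfold Ipos. destruct (Req_EM_T nu 0) as [E0|Hnu].
  - rewrite Hphi; [|lra]. rewrite E0 Rplus_0_r GN rpow_INR; [|lra].
    rewrite Rpower_O; [|lra]. rewrite H1z lens_wu_bracket; [|exact Hz1].
    unfold K. field. repeat split; try apply INR_fact_neq_0. apply pow_nonzero; lra.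
  - assert (Hnu0 : 0 < nu) by (unfold nu in *; lra).
    destruct (is_Gamma_exists_small nu) as [g [Hg Hg0]]; [unfold nu in *; lra|].
    rewrite (is_Gamma_unique nu g Hg).
    replace (INR m + nu + 1) with (nu + INR (S m)) by (rewrite S_INR; ring).
    (* [Gamma (l - k + 1)] becomes [g] times a Pochhammer symbol, and this [g] matches the
       normalisation of the fractional kernel. *)
    rewrite (is_Gamma_unique _ _ (is_Gamma_poch nu g (S m) Hnu0 Hg)).
    apply (@is_RInt_gen_unique R_CompleteNormedModule _ _
      (Proper_StrongProper _ (at_right_proper_filter s))
      (Proper_StrongProper _ (Rbar_locally_filter p_infty))).
    assert (Hmp := pos_INR m).
    assert (near_s : filter_prod (at_right s) (Rbar_locally p_infty)
      (fun ab => s < fst ab /\ s < snd ab)).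
    { exists (fun a => s < a) (fun c => s < c); [|now exists s|auto].
      exists (mkposreal 1 Rlt_0_1). auto. }
    (* At [r = 2] the integration starts where the support ends, and [is_RInt_gen_lens], which asks
       for [s < 2], does not apply. The integrand is zero, and so is the right-hand side, the
       exponent [m + nu] of the base [0] being positive. *)
    destruct (Req_dec s 2) as [Es|Es].
    + assert (z = 0) as -> by lra.
      unfold rpow. destruct (Req_EM_T 0 0); [|lra]. destruct (Req_EM_T (INR m + nu) 0); [lra|].
      rewrite Rmult_0_r Rmult_0_l.
      apply (is_RInt_gen_near_const _ (at_right s) (Rbar_locally p_infty)).
      apply: filter_imp near_s. intros [a c] [Ha Hc]. simpl in Ha, Hc |- *.
      apply is_RInt_zero. intros x Hx.
      assert (s < x) by (apply Rlt_trans with (2 := proj1 Hx); now apply Rmin_glb_lt).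
      rewrite Hphi; [|lra]. rewrite lens_ge_1; [ring|lra].
    + assert (I := is_RInt_gen_lens l m s nu z Hnu0 ltac:(lra) Hz).
      apply (is_RInt_gen_scal _ (K / g)) in I.
      assert (Hzp : 0 < z) by lra.
      assert (Er : rpow z (INR m + nu) = z ^ m * Rpower z nu).
      { unfold rpow. destruct (Req_EM_T z 0); [lra|].
        now rewrite Rpower_plus Rpower_pow. }
      replace (_ * _) with (scal (K / g) (z ^ m * Rpower (2 * z) nu * INR (fact m) / poch nu (S m)
        * wu_bracket l (nu + INR (S m)) z)).
      * apply: is_RInt_gen_ext I. apply: filter_imp near_s.
        intros [a c] [Ha Hc] x Hx. simpl in Ha, Hc, Hx |- *.
        assert (s < x) by (apply Rlt_trans with (2 := proj1 Hx); now apply Rmin_glb_lt).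
        rewrite Hphi; [|lra].
        change (K / g * (Rpower (x - s) (nu - 1) * lens l m (x / 2)) =
          Rpower (x - s) (nu - 1) / g * (K * lens l m (x / 2))).
        field. lra.
      * rewrite Er -(Rpower_mult_distr 2 z nu); [|lra|exact Hzp].
        set W := wu_bracket _ _ _. unfold K.
        change (2 ^ (2 * l + 1) / 2 ^ n * (INR (fact l) / INR (fact m)) / g *
          (z ^ m * (Rpower 2 nu * Rpower z nu) * INR (fact m) / poch nu (S m) * W) =
          2 ^ (2 * l + 1) / 2 ^ n * Rpower 2 nu * INR (fact l) / (g * poch nu (S m))
          * (z ^ m * Rpower z nu) * W).
        assert (Pp := poch_pos nu (S m) Hnu0). set pp := poch nu (S m) in Pp |- *.
        field. repeat split; try apply INR_fact_neq_0; try lra. apply pow_nonzero; lra.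
Qed.
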